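(* Let $\Gamma$ be a non-elementary hyperbolic group. Then for all large enough $p$ (that is, there is $p_0\in[1,\infty)$ such that for all $p\in[p_0,\infty)$) the linear isometric action of $\Gamma$ on the first $\ell^p$-cohomology group $H^1_{(p)}(\Gamma)$ admits a proper cocycle.
   Context: **$\ell^p$-cohomology in degree one.** For a finitely generated group $\Gamma$, consider its Cayley graph with respect to a finite generating set, on which $\Gamma$ acts by left multiplication. Let $E_p(\Gamma)$ be the linear space of functions $\phi:\Gamma\to\mathbb R$ with $\|\phi\|_{E_p}=\big(\sum|\phi(x)-\phi(y)|^p\big)^{1/p}<\infty$, the sum being over all edges of the Cayley graph, where $x,y$ denote the endpoints of the edge. The first $\ell^p$-cohomology group is the quotient $H^1_{(p)}(\Gamma)=E_p(\Gamma)/(\ell^p\Gamma+\mathbb R)$, where $\mathbb R$ stands for the constant functions, equipped with the norm induced by the ($\Gamma$-invariant) seminorm $\|\cdot\|_{E_p}$. Different finite generating sets give the same space with comparable seminorms, and $H^1_{(p)}(\Gamma)$ is a Banach space when $\Gamma$ is non-amenable. The linear isometric action of $\Gamma$ on $H^1_{(p)}(\Gamma)$ is induced by $(g.\phi)(x)=\phi(g^{-1}x)$. **Cocycles.** Throughout, $p\in[1,\infty)$. A cocycle for a linear isometric action of $\Gamma$ on a Banach space $V$ is a map $c:\Gamma\to V$, $g\mapsto c_g$, with $c_{gh}=g.c_h+c_g$ for all $g,h\in\Gamma$; it is proper if $\|c_g\|\to\infty$ as $g\to\infty$ in $\Gamma$ (i.e. for every $R$ only finitely many $g$ have $\|c_g\|\le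 R$). *)

(* Defs.v *)
From HB Require Import structures.
From mathcomp Require Import all_boot all_order all_algebra ring_quotient.
From mathcomp Require Import finmap.
From mathcomp Require Import all_classical all_reals all_analysis.
From mathcomp Require Import ring lra.

Set Implicit Arguments.
Unset Strict Implicit.
Unset Printing Implicit Defensive.

Import Order.TTheory GRing.Theory Num.Theory.
Local Open Scope classical_set_scope.
Local Open Scope ring_scope.

Record seminorm (R : numDomainType) (V : lmodType R) := Seminorm {
  snorm :> V -> R;
  ler_snormD : forall u v, snorm (u + v) <= snorm u + snorm v;
  snormZ : forall k v, snorm (k *: v) = `|k| * snorm v
}.

Section SeminormTheory.
Variables (R : numDomainType) (V : lmodType R) (N : seminorm V).

Lemma snorm0 : N 0 = 0.
Proof. by rewrite -[0 in LHS](scale0r 0) snormZ normr0 mul0r. Qed.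

Lemma snormN v : N (- v) = N v.
Proof. by rewrite -scaleN1r snormZ normrN1 mul1r. Qed.

Lemma snorm_ge0 v : 0 <= N v.
Proof.
have: N (v - v) <= N v + N (- v) by exact: ler_snormD.
by rewrite subrr snorm0 snormN -mulr2n pmulrn_lge0.
Qed.

End SeminormTheory.

Section LmoduleQuotient.
Variables (R : pzRingType) (V : lmodType R) (I : submodClosed V).

(* A [submodClosed] predicate over a ring is closed under opposites, but this
   is not an inheritance of the library. *)
Definition submod_pred : {pred V} := I.
HB.instance Definition _ := GRing.isZmodClosed.Build V submod_pred
  (GRing.subsemimod_closedB (GRing.subsemimodClosedP I)).

Definition lmod_quot := Quotient.quot submod_pred.
HB.instance Definition _ := GRing.Zmodule.on lmod_quot.

Definition lmod_pi (v : V) : lmod_quot := \pi_(Quotient.quot submod_pred)%qT v.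
Definition lmod_repr (x : lmod_quot) : V := @repr _ (Quotient.quot submod_pred) x.

Lemma lmod_piP (u v : V) : reflect (lmod_pi u = lmod_pi v) (u - v \in I).
Proof.
have -> : (u - v \in I) = (u - v \in submod_pred) by [].
by rewrite (Quotient.idealrBE submod_pred); apply: eqP.
Qed.

Lemma lmod_reprK : cancel lmod_repr lmod_pi.
Proof. exact: (@reprK _ (Quotient.quot submod_pred)). Qed.

Lemma lmod_piD : {morph lmod_pi : u v / u + v}.
Proof. exact: (raddfD \pi_(Quotient.quot submod_pred)%qT). Qed.

Definition lmod_quot_scale (k : R) (x : lmod_quot) : lmod_quot :=
  lmod_pi (k *: lmod_repr x).

Local Lemma scale_pi k v : lmod_quot_scale k (lmod_pi v) = lmod_pi (k *: v).
Proof.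
by apply/lmod_piP; rewrite -scalerBr rpredZ//; apply/lmod_piP/lmod_reprK.
Qed.

Local Lemma scaleA a b x :
  lmod_quot_scale a (lmod_quot_scale b x) = lmod_quot_scale (a * b) x.
Proof. by rewrite -[x]lmod_reprK !scale_pi scalerA. Qed.

Local Lemma scale1 : left_id 1 lmod_quot_scale.
Proof. by move=> x; rewrite -[x]lmod_reprK scale_pi scale1r. Qed.

Local Lemma scaleDr : right_distributive lmod_quot_scale +%R.
Proof.
move=> a x y; rewrite -[x]lmod_reprK -[y]lmod_reprK.
by rewrite -lmod_piD !scale_pi -lmod_piD scalerDr.
Qed.

Local Lemma scaleDl x : {morph lmod_quot_scale^~ x : a b / a + b}.
Proof.
by move=> a b; rewrite -[x]lmod_reprK !scale_pi -lmod_piD scalerDl.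
Qed.

HB.instance Definition _ := GRing.Zmodule_isLmodule.Build R lmod_quot
  scaleA scale1 scaleDr scaleDl.

Lemma lmod_piZ k v : lmod_pi (k *: v) = k *: lmod_pi v.
Proof. by rewrite -scale_pi. Qed.

End LmoduleQuotient.

Section QuotientSeminorm.
Variables (R : realType) (V : lmodType R) (N : seminorm V) (I : submodClosed V).

Definition quot_norm (x : lmod_quot I) : R :=
  inf [set N v | v in [set v | lmod_pi I v = x]].

Local Lemma norm_has_inf x : has_inf [set N v | v in [set v | lmod_pi I v = x]].
Proof.
split; first by exists (N (lmod_repr x)), (lmod_repr x) => //=; rewrite lmod_reprK.
by exists 0 => _ [v _ <-]; exact: snorm_ge0.
Qed.

Local Lemma quot_norm_le v : quot_norm (lmod_pi I v) <= N v.
Proof. by apply: ge_inf; [case: (norm_has_inf (lmod_pi I v))|exists v]. Qed.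

Local Lemma quot_normD x y : quot_norm (x + y) <= quot_norm x + quot_norm y.
Proof.
apply/ler_addgt0Pr => e e0.
have e20 : 0 < e / 2 by rewrite divr_gt0.
have [_ [u ux <-] hu] := inf_adherent e20 (norm_has_inf x).
have [_ [v vy <-] hv] := inf_adherent e20 (norm_has_inf y).
rewrite -ux -vy -lmod_piD (le_trans (quot_norm_le _))//.
rewrite (le_trans (ler_snormD _ _ _))// ux vy.
by rewrite /quot_norm; move: hu hv; lra.
Qed.

Local Lemma quot_normZ_le k x : quot_norm (k *: x) <= `|k| * quot_norm x.
Proof.
apply/ler_addgt0Pr => e e0.
have e'0 : 0 < e / (1 + `|k|) by rewrite divr_gt0// ltr_pwDl.
have [_ [u ux <-] hu] := inf_adherent e'0 (norm_has_inf x).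
rewrite -ux -lmod_piZ (le_trans (quot_norm_le _))// ux snormZ.
rewrite (@le_trans _ _ (`|k| * (quot_norm x + e / (1 + `|k|))))//.
  by rewrite ler_wpM2l// ltW.
rewrite mulrDr lerD2l mulrCA ler_piMr ?(ltW e0)//.
by rewrite ler_pdivrMr ?ltr_pwDl// mul1r lerDr.
Qed.

Local Lemma quot_normZ k x : quot_norm (k *: x) = `|k| * quot_norm x.
Proof.
apply/eqP; rewrite eq_le quot_normZ_le/=.
have [->|k0] := eqVneq k 0.
  rewrite normr0 mul0r; apply: lb_le_inf; first by case: (norm_has_inf (0 *: x)).
  by move=> _ [v _ <-]; exact: snorm_ge0.
rewrite -[x in leLHS](scalerK k0) mulrC -ler_pdivlMr ?normr_gt0//.
by rewrite mulrC -normfV quot_normZ_le.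
Qed.

Definition quot_seminorm : seminorm (lmod_quot I) :=
  Seminorm quot_normD quot_normZ.

End QuotientSeminorm.

Section WeightedSum.
Variables (R : realType) (T : choiceType) (D : set T) (c p : R).
Hypotheses (c0 : 0 <= c) (p1 : 1 <= p).
Implicit Types (f g : T -> R) (A B k : R).
Local Open Scope ereal_scope.

Definition wsum f : \bar R := c%:E * \esum_(i in D) (`|f i|%R `^ p)%:E.

Let p0 : (0 < p)%R. Proof. exact: lt_le_trans p1. Qed.

Lemma wsum_ge0 f : 0 <= wsum f.
Proof. by rewrite mule_ge0 ?lee_fin ?esum_ge0// => i _; rewrite lee_fin powR_ge0. Qed.

Lemma wsum_le f A : (0 <= A)%R ->
  (forall X : {fset T}, (forall i, i \in X -> D i) ->
     (c * (\sum_(i <- X) `|f i| `^ p) <= A)%R) ->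
  wsum f <= A%:E.
Proof.
move=> A0 fA; rewrite /wsum; have [->|cN0] := eqVneq c 0%R.
  by rewrite mul0e lee_fin.
rewrite -lee_pdivlMl ?lt_neqAle 1?eq_sym ?cN0//.
apply: ge_ereal_sup => _ [X [finX XD] <-].
rewrite fsbig_finite//= sumEFin lee_fin ler_pdivlMl ?lt_neqAle 1?eq_sym ?cN0//.
by apply: fA => i; rewrite in_fset_set// inE; exact: XD.
Qed.

Lemma le_wsum f A (X : {fset T}) : wsum f <= A%:E ->
  (forall i, i \in X -> D i) -> (c * (\sum_(i <- X) `|f i| `^ p) <= A)%R.
Proof.
move=> fA XD; rewrite -lee_fin (le_trans _ fA)// EFinM lee_wpmul2l//.
apply: esum_ge; exists [set` X]; first by split=> //; exact: finite_fset.
by rewrite fsbig_finite//= set_fsetK sumEFin.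
Qed.

Lemma wsumD f g A B : (0 < A)%R -> (0 < B)%R ->
  wsum f <= (A `^ p)%:E -> wsum g <= (B `^ p)%:E ->
  wsum (f + g)%R <= ((A + B) `^ p)%:E.
Proof.
move=> A0 B0 fA gB; apply: wsum_le; first exact: powR_ge0.
move=> X XD; have AB0 : (0 < A + B)%R by rewrite addr_gt0.
pose t := (A / (A + B))%R.
have t01 : (0 <= t <= 1)%R.
  by rewrite /t divr_ge0 ?(ltW A0) ?(ltW AB0)//= ler_pdivrMr// mul1r lerDl ltW.
have tE : (1 - t = B / (A + B))%R by rewrite /t; field; rewrite gt_eqF.
case/andP: t01 => t0 t1.
have key i : (`|(f + g)%R i| `^ p <= (A + B) `^ p *
    (t / A `^ p * `|f i| `^ p + (1 - t) / B `^ p * `|g i| `^ p))%R.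
  have -> : (t / A `^ p * `|f i| `^ p + (1 - t) / B `^ p * `|g i| `^ p =
             t * (`|f i| / A) `^ p + (1 - t) * (`|g i| / B) `^ p)%R.
    have powRV x : (0 < x)%R -> (x^-1 `^ p = (x `^ p)^-1)%R.
      by move=> /ltW x0; rewrite -(powR_inv1 x0) -powRrM mulN1r powRN.
    by rewrite !powRM ?invr_ge0 ?(ltW A0) ?(ltW B0)// !powRV//; ring.
  have s0 : (0 <= t * (`|f i| / A) + (1 - t) * (`|g i| / B))%R.
    by apply: addr_ge0; apply: mulr_ge0 => //; rewrite ?subr_ge0// divr_ge0// ltW.
  apply: (@le_trans _ _ (((A + B) *
      (t * (`|f i| / A) + (1 - t) * (`|g i| / B))) `^ p)%R).
    rewrite ge0_ler_powR ?nnegrE ?(ltW p0)//.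
      by rewrite mulr_ge0 ?(ltW AB0).
    rewrite (le_trans (ler_normD _ _))// tE /t le_eqVlt; apply/orP; left.
    by apply/eqP; field; rewrite !gt_eqF.
  rewrite powRM ?(ltW AB0)// ler_wpM2l ?powR_ge0//.
  apply: (convex_powR p1 (Itv01 t0 t1)) => //=;
    by rewrite ?inE/= ?in_itv/= andbT divr_ge0 ?(ltW A0) ?(ltW B0).
have le1 := le_wsum fA XD; have le2 := le_wsum gB XD.
have Ap : (0 < A `^ p)%R by rewrite powR_gt0.
have Bp : (0 < B `^ p)%R by rewrite powR_gt0.
apply: (@le_trans _ _ ((A + B) `^ p *
   (t / A `^ p * (c * \sum_(i <- X) `|f i| `^ p) +
    (1 - t) / B `^ p * (c * \sum_(i <- X) `|g i| `^ p)))%R).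
  apply: (@le_trans _ _ (c * \sum_(i <- X) (A + B) `^ p *
    (t / A `^ p * `|f i| `^ p + (1 - t) / B `^ p * `|g i| `^ p))%R).
    by rewrite ler_wpM2l// ler_sum.
  rewrite -mulr_sumr big_split/= -!mulr_sumr le_eqVlt; apply/orP; left.
  by apply/eqP; ring.
rewrite ler_piMr ?powR_ge0//.
rewrite [leRHS](_ : _ = (t / A `^ p * A `^ p + (1 - t) / B `^ p * B `^ p)%R); last first.
  by rewrite !divfK ?gt_eqF// subrKC.
by rewrite lerD// ler_wpM2l// divr_ge0 ?subr_ge0 ?powR_ge0.
Qed.

Lemma wsumZ k f : wsum f < +oo -> wsum (k *: f)%R <= (`|k| `^ p)%:E * wsum f.
Proof.
move=> fy; have ff : wsum f \is a fin_num by rewrite ge0_fin_numE ?wsum_ge0.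
rewrite -(fineK ff) -EFinM; apply: wsum_le.
  by rewrite mulr_ge0 ?powR_ge0// fine_ge0 ?wsum_ge0.
move=> X XD; under eq_bigr do rewrite /= normrM powRM//.
rewrite -mulr_sumr mulrCA ler_wpM2l ?powR_ge0//.
by apply: le_wsum => //; rewrite fineK.
Qed.

Definition wnorm f : R := fine (wsum f) `^ p^-1.

Lemma wnorm_ge0 f : (0 <= wnorm f)%R. Proof. exact: powR_ge0. Qed.

Lemma wnormK f : wsum f < +oo -> wsum f = (wnorm f `^ p)%:E.
Proof.
move=> fy; rewrite /wnorm -powRrM mulVf ?gt_eqF// powRr1 ?fine_ge0 ?wsum_ge0//.
by rewrite fineK// ge0_fin_numE ?wsum_ge0.
Qed.

Lemma wnorm_le f A : (0 <= A)%R -> wsum f <= (A `^ p)%:E -> (wnorm f <= A)%R.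
Proof.
move=> A0 fA; have fy : wsum f < +oo by rewrite (le_lt_trans fA) ?ltry.
rewrite -[leRHS](powRr1 A0) -(@mulfV _ p) ?gt_eqF// powRrM.
rewrite ge0_ler_powR ?invr_ge0 ?(ltW p0) ?nnegrE ?fine_ge0 ?wsum_ge0 ?powR_ge0//.
by rewrite -lee_fin fineK// ge0_fin_numE ?wsum_ge0.
Qed.

Lemma wsum_le_wnorm f A : wsum f < +oo -> (wnorm f <= A)%R ->
  wsum f <= (A `^ p)%:E.
Proof.
move=> fy fA; rewrite wnormK// lee_fin ge0_ler_powR ?(ltW p0)// ?nnegrE ?wnorm_ge0//.
by rewrite (le_trans (wnorm_ge0 f)).
Qed.

Lemma wsumD_fin f g : wsum f < +oo -> wsum g < +oo -> wsum (f + g)%R < +oo.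
Proof.
move=> fy gy.
have A0 : (0 < wnorm f + 1)%R by rewrite ltr_wpDl ?wnorm_ge0.
have B0 : (0 < wnorm g + 1)%R by rewrite ltr_wpDl ?wnorm_ge0.
apply: le_lt_trans (ltry ((wnorm f + 1 + (wnorm g + 1)) `^ p)).
apply: (wsumD A0 B0).
  by apply: (wsum_le_wnorm fy); rewrite lerDl ler01.
by apply: (wsum_le_wnorm gy); rewrite lerDl ler01.
Qed.

Lemma wsumZ_fin k f : wsum f < +oo -> wsum (k *: f)%R < +oo.
Proof.
move=> fy; apply: le_lt_trans (wsumZ k fy) _.
by rewrite wnormK// -EFinM ltry.
Qed.

Lemma wsum0 : wsum 0%R = 0.
Proof.
by rewrite /wsum esum1 ?mule0// => i _; rewrite normr0 powR0 ?gt_eqF.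
Qed.

Lemma wnormD f g : wsum f < +oo -> wsum g < +oo ->
  (wnorm (f + g) <= wnorm f + wnorm g)%R.
Proof.
move=> fy gy; apply/ler_addgt0Pr => e e0.
have e20 : (0 < e / 2)%R by rewrite divr_gt0.
have A0 : (0 < wnorm f + e / 2)%R by rewrite ltr_wpDl ?wnorm_ge0.
have B0 : (0 < wnorm g + e / 2)%R by rewrite ltr_wpDl ?wnorm_ge0.
have -> : (wnorm f + wnorm g + e = (wnorm f + e / 2) + (wnorm g + e / 2))%R.
  by rewrite addrACA -splitr.
apply: wnorm_le; first exact: ltW (addr_gt0 A0 B0).
apply: (wsumD A0 B0).
  by apply: (wsum_le_wnorm fy); rewrite lerDl ltW.
by apply: (wsum_le_wnorm gy); rewrite lerDl ltW.
Qed.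

Lemma wnormZ k f : wsum f < +oo -> wnorm (k *: f)%R = (`|k| * wnorm f)%R.
Proof.
have le_wnormZ a g : wsum g < +oo -> (wnorm (a *: g) <= `|a| * wnorm g)%R.
  move=> gy; apply: wnorm_le; first by rewrite mulr_ge0 ?wnorm_ge0.
  by rewrite (le_trans (wsumZ a gy))// wnormK// -EFinM powRM ?wnorm_ge0.
move=> fy; apply/eqP; rewrite eq_le le_wnormZ//=.
have [->|k0] := eqVneq k 0%R; first by rewrite normr0 mul0r wnorm_ge0.
rewrite -[f in leLHS](scalerK k0) mulrC -ler_pdivlMr ?normr_gt0//.
by rewrite mulrC -normfV le_wnormZ// wsumZ_fin.
Qed.

End WeightedSum.

Section WordMetric.
Variables (G : groupType) (S : {fset G}).
Implicit Types (s x y g : G) (w : seq G).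

Definition letter s : bool := (s \in S) || (s^-1%g \in S).

Definition spells w g := all letter w /\ (\prod_(s <- w) s)%g = g.

Definition generates : Prop := forall g, exists w, spells w g.

Hypothesis genS : generates.

Local Lemma spell_size g : exists n, `[< exists2 w, spells w g & size w = n >].
Proof. by have [w wg] := genS g; exists (size w); apply/asboolP; exists w. Qed.

Definition word_length g : nat := ex_minn (spell_size g).

Definition word_dist x y : nat := word_length (x^-1 * y)%g.

Definition gromov_product (R : realType) (o x y : G) : R :=
  ((word_dist x o)%:R + (word_dist y o)%:R - (word_dist x y)%:R) / 2.

End WordMetric.

(* Gromov's inequality on the vertices of the Cayley graph, i.e. on [G] with the
   word metric. *)
Definition hyperbolic_group (R : realType) (G : groupType) : Prop :=
  exists (S : {fset G}) (genS : generates S) (delta : R), forall o x y z : G,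
    Num.min (gromov_product genS R o x y) (gromov_product genS R o y z) - delta
      <= gromov_product genS R o x z.

Definition in_cycle (G : groupType) (a h : G) : Prop :=
  exists n : nat, h = (a ^+ n)%g \/ h = (a ^- n)%g.

(* Finitely many left cosets of a cyclic subgroup cover the group; this covers
   both the finite groups and the virtually infinite cyclic ones. *)
Definition virtually_cyclic (G : groupType) : Prop :=
  exists (a : G) (F : {fset G}), forall g : G,
    exists2 f, f \in F & in_cycle a (f^-1 * g)%g.

Record linear_isometric_action (G : groupType) (R : numDomainType)
    (V : lmodType R) (N : seminorm V) := LinearIsometricAction {
  act :> G -> V -> V;
  act_linear : forall g, linear (act g);
  act1 : forall v, act 1%g v = v;
  actM : forall g h v, act (g * h)%g v = act g (act h v);
  act_isometric : forall g v, N (act g v) = N v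
}.

Definition is_cocycle (G : groupType) (R : numDomainType) (V : lmodType R)
    (N : seminorm V) (a : linear_isometric_action G N) (c : G -> V) : Prop :=
  forall g h, c (g * h)%g = a g (c h) + c g.

Definition is_proper (G : groupType) (R : numDomainType) (V : lmodType R)
    (N : seminorm V) (c : G -> V) : Prop :=
  forall M : R, finite_set [set g | N (c g) <= M].

Section QuotientAction.
Variables (G : groupType) (R : realType) (V : lmodType R) (N : seminorm V).
Variables (a : linear_isometric_action G N) (I : submodClosed V).
Hypothesis aI : forall g v, v \in I -> a g v \in I.

Definition quot_act (g : G) (x : lmod_quot I) : lmod_quot I :=
  lmod_pi I (a g (lmod_repr x)).

Local Lemma actB g u v : a g (u - v) = a g u - a g v.
Proof. by rewrite addrC -scaleN1r act_linear scaleN1r addrC. Qed.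

Lemma quot_act_pi g v : quot_act g (lmod_pi I v) = lmod_pi I (a g v).
Proof.
by apply/lmod_piP; rewrite -actB; apply/aI/lmod_piP/lmod_reprK.
Qed.

Local Lemma quot_act_linear g : linear (quot_act g).
Proof.
move=> k x y; rewrite -[x]lmod_reprK -[y]lmod_reprK -lmod_piZ -lmod_piD.
by rewrite !quot_act_pi act_linear lmod_piD lmod_piZ.
Qed.

Local Lemma quot_act1 x : quot_act 1%g x = x.
Proof. by rewrite -[x]lmod_reprK quot_act_pi act1. Qed.

Local Lemma quot_actM g h x : quot_act (g * h)%g x = quot_act g (quot_act h x).
Proof. by rewrite -[x]lmod_reprK !quot_act_pi actM. Qed.

Local Lemma quot_act_isometric g x : quot_seminorm N I (quot_act g x) = quot_seminorm N I x.
Proof.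
congr inf; apply/seteqP; split=> _ [v /= vx <-].
- exists (a g^-1%g v); last exact: act_isometric.
  by rewrite /= -quot_act_pi vx -quot_actM mulVg quot_act1.
- exists (a g v); last exact: act_isometric.
  by rewrite /= -quot_act_pi vx.
Qed.

Definition quot_action : linear_isometric_action G (quot_seminorm N I) :=
  LinearIsometricAction quot_act_linear quot_act1 quot_actM quot_act_isometric.

End QuotientAction.

Section LpCohomology.
Variables (R : realType) (G : groupType) (S : {fset G}) (p : R).
Hypothesis p1 : 1 <= p.
Implicit Types (phi : G -> R) (g x : G) (k : R).

(* The oriented edges of the simple Cayley graph. *)
Definition arcs : set (G * G) :=
  [set e | e.1 != e.2 /\ letter S (e.1^-1 * e.2)%g].

(* The sum over the (unoriented) edges; each is the support of two arcs. *)
Definition Ep_energy phi : \bar R :=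
  ((2^-1)%:E * \esum_(e in arcs) (`|phi e.1 - phi e.2| `^ p)%:E)%E.

Definition lp_energy phi : \bar R := \esum_(x in [set: G]) (`|phi x| `^ p)%:E.

Definition translate g phi : G -> R := fun x => phi (g^-1 * x)%g.

Local Definition diff phi : G * G -> R := fun e => phi e.1 - phi e.2.

Local Lemma diffD phi psi : diff (phi + psi) = diff phi + diff psi.
Proof. by apply/funext => e; rewrite /diff !fctE; ring. Qed.

Local Lemma diffZ k phi : diff (k *: phi) = k *: diff phi.
Proof. by apply/funext => e; rewrite /diff !fctE /= -mulrBr. Qed.

Local Lemma half_ge0 : 0 <= 2^-1 :> R. Proof. by rewrite invr_ge0. Qed.
#[local] Hint Resolve half_ge0 : core.

Local Lemma Ep_energyE phi : Ep_energy phi = wsum arcs 2^-1 p (diff phi).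
Proof. by []. Qed.

Local Lemma lp_energyE phi : lp_energy phi = wsum [set: G] 1 p phi.
Proof. by rewrite /wsum mul1e. Qed.

(* The proof argument is only there for canonical structures to find it. *)
Definition Ep_pred of 1 <= p : {pred G -> R} :=
  mem [set phi | (Ep_energy phi < +oo)%E].

Local Lemma Ep_submod_closed : submod_closed (Ep_pred p1).
Proof.
split=> [|k phi psi].
  rewrite inE /= Ep_energyE (_ : diff 0 = 0) ?wsum0 ?ltry//.
  by apply/funext => e; rewrite /diff subrr.
rewrite !inE /= !Ep_energyE diffD diffZ => phiy psiy.
exact: wsumD_fin (wsumZ_fin _ _ _ phiy) psiy.
Qed.

HB.instance Definition _ := GRing.isSubmodClosed.Build R (G -> R) (Ep_pred p1)
  Ep_submod_closed.

Record Ep := MkEp { Ep_fun :> G -> R; _ : Ep_fun \in Ep_pred p1 }.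

HB.instance Definition _ := [isSub for Ep_fun].
HB.instance Definition _ := [Choice of Ep by <:].
HB.instance Definition _ := [SubChoice_isSubLmodule of Ep by <:].

Local Lemma Ep_finite (phi : Ep) : (Ep_energy phi < +oo)%E.
Proof. by have := valP phi; rewrite inE. Qed.

Definition Ep_norm (phi : Ep) : R := fine (Ep_energy phi) `^ p^-1.

Local Lemma Ep_normD (phi psi : Ep) : Ep_norm (phi + psi) <= Ep_norm phi + Ep_norm psi.
Proof.
rewrite /Ep_norm Ep_energyE (_ : diff _ = diff phi + diff psi) -?diffD//.
by rewrite diffD; exact: wnormD half_ge0 p1 _ _ (Ep_finite phi) (Ep_finite psi).
Qed.

Local Lemma Ep_normZ k (phi : Ep) : Ep_norm (k *: phi) = `|k| * Ep_norm phi.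
Proof.
rewrite /Ep_norm Ep_energyE (_ : diff _ = k *: diff phi) -?diffZ//.
by rewrite diffZ; exact: wnormZ half_ge0 p1 _ _ (Ep_finite phi).
Qed.

Definition Ep_seminorm : seminorm Ep := Seminorm Ep_normD Ep_normZ.

Lemma Ep_energy_translate g phi : Ep_energy (translate g phi) = Ep_energy phi.
Proof.
congr (_ * _)%E; rewrite [RHS](@reindex_esum _ _ _ arcs arcs
  (fun e => (g^-1 * e.1, g^-1 * e.2)%g))//.
split.
- move=> [x y] /= [xy l]; split; first by rewrite /= (inj_eq (mulgI _)).
  by rewrite /= invgM invgK -mulgA mulVKg.
- by move=> [x y] [x' y'] _ _ /= [/mulgI -> /mulgI ->].
- move=> [x y] /= [xy l]; exists (g * x, g * y)%g; last by rewrite /= !mulKg.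
  split; first by rewrite /= (inj_eq (mulgI _)).
  by rewrite /= invgM -mulgA mulKg.
Qed.

Lemma lp_energy_translate g phi : lp_energy (translate g phi) = lp_energy phi.
Proof.
rewrite [RHS](@reindex_esum _ _ _ setT setT (fun x => g^-1 * x)%g)//.
split=> //; first by move=> x y _ _ /mulgI.
by move=> x _; exists (g * x)%g => //; rewrite mulKg.
Qed.

Local Lemma translate_subproof g (phi : Ep) : translate g phi \in Ep_pred p1.
Proof. by rewrite inE /= Ep_energy_translate; exact: Ep_finite. Qed.

Definition Ep_translate g (phi : Ep) : Ep := MkEp (translate_subproof g phi).

Local Lemma Ep_translate_linear g : linear (Ep_translate g).
Proof. by move=> k phi psi; apply/val_inj. Qed.

Local Lemma Ep_translate1 (phi : Ep) : Ep_translate 1%g phi = phi.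
Proof. by apply/val_inj/funext => x; rewrite /= /translate invg1 mul1g. Qed.

Local Lemma Ep_translateM g h (phi : Ep) :
  Ep_translate (g * h)%g phi = Ep_translate g (Ep_translate h phi).
Proof. by apply/val_inj/funext => x; rewrite /= /translate invgM mulgA. Qed.

Local Lemma Ep_translate_isometric g (phi : Ep) : Ep_seminorm (Ep_translate g phi) = Ep_seminorm phi.
Proof. by rewrite /= /Ep_norm Ep_energy_translate. Qed.

Definition Ep_action : linear_isometric_action G Ep_seminorm :=
  LinearIsometricAction Ep_translate_linear Ep_translate1 Ep_translateM
    Ep_translate_isometric.

Lemma lp_energy_Ep phi : (lp_energy phi < +oo)%E -> phi \in Ep_pred p1.
Proof.
move=> phiy; rewrite inE /= Ep_energyE.
pose n := #|` (S `|` [fset s^-1%g | s in S])%fset|.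
have fst_fin : (wsum arcs 2^-1 p (fun e => phi e.1) < +oo)%E.
  rewrite /wsum lte_mul_pinfty ?lee_fin//.
  have -> : arcs = [set: G] `*`` (fun x => [set y | arcs (x, y)]).
    by apply/seteqP; split=> [[x y]|[x y] []].
  rewrite -(@esum_esum _ _ _ _ _ (fun x _ => (`|phi x| `^ p)%:E))//.
  apply: (@le_lt_trans _ _ (n%:R%:E * lp_energy phi)%E); last first.
    by rewrite lte_mul_pinfty ?lee_fin.
  rewrite -[leRHS]/(wsum [set: G] n%:R p phi).
  have phif : lp_energy phi \is a fin_num.
    by rewrite ge0_fin_numE// lp_energyE wsum_ge0.
  apply: ge_ereal_sup => _ [X [finX _] <-].
  rewrite fsbig_finite//=.
  apply: (@le_trans _ _ (\sum_(x <- fset_set X) (n%:R * `|phi x| `^ p)%:E)%E).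
    apply: lee_sum => x _; apply: ge_ereal_sup => _ [Y [finY YJ] <-].
    rewrite fsbig_finite//= sumEFin lee_fin big_const_seq count_predT iter_addr addr0.
    rewrite -[leLHS]mulr_natl ler_wpM2r ?powR_ge0// ler_nat /n.
    apply: (@leq_trans #|` [fset (x * s)%g | s in (S `|` [fset s^-1%g | s in S])%fset]%fset|);
      last by rewrite card_imfset//; exact: mulgI.
    apply/fsubset_leq_card/fsubsetP => y; rewrite in_fset_set// inE => /YJ [_ /= l].
    apply/imfsetP; exists (x^-1 * y)%g; last by rewrite mulVKg.
    rewrite /= in_fsetU; case/orP: l => [->//|l]; apply/orP; right.
    by apply/imfsetP; exists (x^-1 * y)^-1%g; rewrite ?invgK.
  rewrite sumEFin -mulr_sumr /wsum EFinM lee_wpmul2l ?lee_fin//.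
  by apply: esum_ge; exists X => //; rewrite fsbig_finite//= sumEFin.
have snd_fin : (wsum arcs 2^-1 p (fun e => phi e.2) < +oo)%E.
  rewrite /wsum (@reindex_esum _ _ _ arcs arcs (fun e => (e.2, e.1)))//.
  have arcC x y : arcs (x, y) -> arcs (y, x).
    rewrite /arcs /letter /= => -[xy l]; split; first by rewrite eq_sym.
    by move: l; rewrite !invgM !invgK orbC.
  split.
  - by move=> [x y] /= /arcC.
  - by move=> [x y] [x' y'] _ _ /= [-> ->].
  - by move=> [x y] /arcC; exists (y, x).
have -> : diff phi = (fun e => phi e.1) + (-1) *: (fun e : G * G => phi e.2).
  by rewrite scaleN1r; apply/funext => e; rewrite !fctE.
exact: wsumD_fin fst_fin (wsumZ_fin _ _ _ snd_fin).
Qed.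

(* By [lp_energy_Ep] this is all of l^p + constants, not just a part of it. *)
Definition lp_const : {pred Ep} := mem [set phi : Ep |
  exists (u : G -> R) (k : R),
    (lp_energy u < +oo)%E /\ phi = u + cst k :> (G -> R)].

Local Lemma lp_const_submod_closed : submod_closed lp_const.
Proof.
split=> [|k phi psi]; rewrite !inE /=.
  exists 0, 0; split; first by rewrite lp_energyE wsum0 ?ltry.
  by rewrite addr0.
move=> [u [a [uy phiE]]] [v [b [vy psiE]]].
exists (k *: u + v), (k * a + b); split.
  move: uy vy; rewrite !lp_energyE => uy vy.
  exact: wsumD_fin (wsumZ_fin _ _ _ uy) vy.
apply/funext => x.
rewrite -[LHS]/(k * phi x + psi x) phiE psiE -[RHS]/(k * u x + v x + (k * a + b)).
by rewrite !fctE; ring.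
Qed.

HB.instance Definition _ := GRing.isSubmodClosed.Build R Ep lp_const
  lp_const_submod_closed.

Lemma lp_const_translate g (phi : Ep) :
  phi \in lp_const -> Ep_action g phi \in lp_const.
Proof.
rewrite !inE /= => -[u [k [uy phiE]]]; exists (translate g u), k.
by rewrite lp_energy_translate; split=> //; rewrite phiE.
Qed.

Definition H1 : lmodType R := lmod_quot lp_const.

Definition H1_norm : seminorm H1 := quot_seminorm Ep_seminorm lp_const.

Definition H1_action : linear_isometric_action G H1_norm :=
  quot_action lp_const_translate.

End LpCohomology.

Arguments Ep_norm {R G S p p1} phi.
Arguments lp_const {R G} S {p} p1.

(* Main.v *)
(** Write [(x|y)_z] for the Gromov product. Since [exp (- eps (x|y)_z)] is a
    quasi-ultrametric, Frink's chain construction turns it, for small [eps], into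
    a comparable function [rho_z] satisfying the triangle inequality. The sum over
    [z] of [max(0, rho_z(a, x) - 1/4)] counts, up to bounded factors, the points
    [z] near a geodesic from [a] to [x]: it is an invariant kernel [N(a, x)]
    which is at least [d(a, x) / 4], and whose mixed differences
    [N(a, x) - N(b, x) - N(a, y) + N(b, y)], for [a, b] close and [x, y] close,
    decay exponentially in [d(a, x)], because every summand is bounded both by
    [2 exp (- eps (x|y)_z)] and by [2 exp (- eps (a|b)_z)]. So the formal coboundary
    [c_g x = N(g, x) - N(1, x)] has finite energy as soon as [p] beats the growth
    of the group.

    For properness, take a free semigroup on [A, B] whose words can be kept away
    from any given direction. If [v] represents [c_g] in cohomology and has energy
    at most [M], then [v x] differs by a constant depending only on [M] from the
    average of [v] over the words of length [n] translated to [x], hence for large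
    [n] from an average of [c_g] (up to the additive constant). At [x = 1] this
    average is at least [N(g, 1) - C] and at [x = g] it is at most [C - N(1, g)],
    whereas [v 1 - v g] is at most [|g| / 4 + C] along a geodesic. *)

Require Import Defs.
From mathcomp Require Import all_boot all_order all_algebra.
From mathcomp Require Import finmap.
From mathcomp Require Import all_classical all_reals all_analysis.
From mathcomp Require Import ring lra zify.
Import Order.TTheory GRing.Theory Num.Theory.
Local Open Scope ring_scope.

Set Implicit Arguments.
Unset Strict Implicit.
Unset Printing Implicit Defensive.

(** * Word length: geodesics, spheres and balls *)

Section WordLength.
Variables (G : groupType) (S : {fset G}).
Hypothesis genS : generates S.
Local Notation len := (word_length genS).
Implicit Types (g h x y : G) (w : seq G).

Lemma letterV g : letter S g^-1%g = letter S g.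
Proof. by rewrite /letter invgK orbC. Qed.

Lemma word_length_spell g : exists2 w, spells S w g & size w = len g.
Proof.
by rewrite /word_length; case: ex_minnP => n /asboolP [w wg sw] _; exists w.
Qed.

Lemma word_length_le w g : spells S w g -> (len g <= size w)%N.
Proof.
rewrite /word_length; case: ex_minnP => n _ min_n wg.
by apply: min_n; apply/asboolP; exists w.
Qed.

Lemma word_length1 : len 1%g = 0%N.
Proof.
apply/eqP; rewrite -leqn0; apply: (@word_length_le [::]).
by split; rewrite ?big_nil.
Qed.

Lemma word_lengthM g h : (len (g * h)%g <= len g + len h)%N.
Proof.
have [w [w1 wg] <-] := word_length_spell g; have [v [v1 vh] <-] := word_length_spell h.
rewrite -size_cat; apply: word_length_le; split; first by rewrite all_cat w1.
by rewrite big_cat /= wg vh.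
Qed.

Lemma word_lengthV g : len g^-1%g = len g.
Proof.
suff le_V h : (len h^-1%g <= len h)%N.
  by apply/eqP; rewrite eqn_leq le_V -{1}[g]invgK le_V.
have [w [w1 wh] <-] := word_length_spell h.
rewrite -(size_rev w) -(size_map (fun s => s^-1%g)); apply: word_length_le; split.
  rewrite all_map all_rev; apply/allP => s sw; rewrite /= letterV.
  exact: (allP w1).
rewrite -wh; elim: w {w1 wh} => [|s w IH]; first by rewrite !big_nil invg1.
by rewrite rev_cons map_rcons big_rcons /= IH big_cons invgM.
Qed.

(** Prefixes of a shortest word: prefix and suffix have length at most [i] and [len g - i], and
    subadditivity forces equality in both. *)
Lemma geodesic g : exists x : nat -> G,
  [/\ x 0%N = 1%g, x (len g) = g,
      forall i, (i < len g)%N -> letter S ((x i)^-1 * x i.+1)%g &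
      forall i, (i <= len g)%N ->
        len (x i) = i /\ len ((x i)^-1 * g)%g = (len g - i)%N].
Proof.
have [w [w1 wg] sw] := word_length_spell g.
pose x i := (\prod_(s <- take i w) s)%g.
have xS i : (i < len g)%N -> x i.+1 = (x i * nth 1%g w i)%g.
  move=> il; rewrite /x (take_nth 1%g) ?sw// -cats1 big_cat /=.
  by rewrite big_seq1.
have xg : x (len g) = g by rewrite /x -sw take_size.
have allsub v : subseq v w -> all (letter S) v.
  by move=> /mem_subseq vw; apply/allP => s /vw; apply/allP.
exists x; split => //.
- by rewrite /x take0 big_nil.
- move=> i il; rewrite xS// mulKg; apply: (allP w1).
  by rewrite mem_nth// sw.
- move=> i il.
  have le1 : (len (x i) <= i)%N.
    rewrite (@leq_trans (size (take i w)))//; last first.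
      by rewrite size_take; case: ltnP.
    by apply: word_length_le; split; rewrite ?allsub ?take_subseq.
  have le2 : (len ((x i)^-1 * g)%g <= len g - i)%N.
    rewrite -[X in (X - i)%N]sw -size_drop; apply: word_length_le; split.
      by rewrite allsub ?drop_subseq.
    by rewrite -wg -{2}(cat_take_drop i w) big_cat /= mulKg.
  have := word_lengthM (x i) ((x i)^-1 * g)%g; rewrite mulVKg => le3.
  by split; lia.
Qed.

Definition letters : {fset G} := (S `|` [fset s^-1%g | s in S])%fset.

Lemma mem_letters s : (s \in letters) = letter S s.
Proof.
rewrite /letters /letter in_fsetU; congr orb.
apply/imfsetP/idP => [[t tS ->]|sS]; first by rewrite invgK.
by exists s^-1%g; rewrite ?invgK.
Qed.

(** Covers the sphere of radius [n], with repetitions and possibly shorter elements; its size is the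
    exponential growth bound. *)
Fixpoint word_sphere n : seq G :=
  if n is n'.+1 then [seq (x * s)%g | x <- word_sphere n', s <- letters]
  else [:: 1%g].

Lemma mem_word_sphere g : g \in word_sphere (len g).
Proof.
have [w [w1 <-] <-] := word_length_spell g.
elim/last_ind: w w1 => [|w s IH]; first by rewrite big_nil inE.
rewrite all_rcons => /andP[sl wl]; rewrite size_rcons big_rcons /=.
by rewrite allpairs_f ?IH// mem_letters.
Qed.

Lemma size_word_sphere n : size (word_sphere n) = (#|` letters| ^ n)%N.
Proof. by elim: n => //= n IH; rewrite size_allpairs IH expnSr. Qed.

Definition word_ball n : seq G := flatten [seq word_sphere i | i <- iota 0 n.+1].

Lemma mem_word_ball n g : (len g <= n)%N -> g \in word_ball n.
Proof.
move=> gn; apply/flatten_mapP; exists (len g); last exact: mem_word_sphere.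
by rewrite mem_iota /=; lia.
Qed.

End WordLength.

(** * Frink's chain construction for a quasi-ultrametric *)

Section Frink.
Variables (R : realType) (T : Type) (q : T -> T -> R) (k : R).
Hypotheses (q_gt0 : forall x y, 0 < q x y) (k1 : 1 <= k) (kk2 : k * k <= 2).
Hypothesis q_ultra : forall x y z, q x z <= k * Num.max (q x y) (q y z).
Implicit Types (x y z : T) (s : seq T).

Fixpoint chain_sum x s : R :=
  if s is y :: s' then q x y + chain_sum y s' else 0.

Lemma chain_sum_ge0 x s : 0 <= chain_sum x s.
Proof. by elim: s x => //= y s IH x; rewrite addr_ge0// ltW. Qed.

Lemma chain_sum_cat x s1 s2 :
  chain_sum x (s1 ++ s2) = chain_sum x s1 + chain_sum (last x s1) s2.
Proof. by elim: s1 x => [|y s1 IH] x /=; rewrite ?add0r// IH addrA. Qed.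

Lemma chain_sum_split x s t : 0 <= t < chain_sum x s ->
  exists s1 y s2, [/\ s = s1 ++ y :: s2, chain_sum x s1 <= t &
    t < chain_sum x s1 + q (last x s1) y].
Proof.
elim: s x t => [|y s IH] x t /andP[t0 ts].
  by move: ts => /=; rewrite ltNge t0.
have [ltq|leq] := ltP t (q x y).
  by exists [::], y, s; split => //=; rewrite add0r.
have [] := IH y (t - q x y); first by rewrite subr_ge0 leq /= ltrBlDl.
move=> s1 [z [s2 [-> le1 lt1]]]; exists (y :: s1), z, s2; split => //=; lra.
Qed.

(* Cutting a chain at the link where half of its length is passed leaves two
   shorter chains of at most half the length. *)
Lemma frink x s : (0 < size s)%N -> q x (last x s) <= 2 * chain_sum x s.
Proof.
elim: {s}(size s) {-2}s (leqnn (size s)) x => [|n IH] s.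
  by case: s.
move=> sn x s0; set c := chain_sum x s.
have c_gt0 : 0 < c.
  rewrite /c; case: s s0 {sn c} => //= y s _.
  by rewrite ltr_pwDl ?chain_sum_ge0.
have [|s1 [y [s2 [sE le1 lt1]]]] := @chain_sum_split x s (c / 2).
  by rewrite -/c; apply/andP; split; lra.
have cE : c = chain_sum x s1 + (q (last x s1) y + chain_sum y s2).
  by rewrite /c sE chain_sum_cat.
have := chain_sum_ge0 x s1; have := chain_sum_ge0 y s2; move=> c2 c1.
move: sn; rewrite sE size_cat /= => sn.
have qu : q (last x s1) y <= c by lra.
have kcc : c <= k * c by rewrite ler_peMl// ltW.
(* By induction the part before the cut link costs at most [2 * (c / 2) = c]; attaching the link
   costs one factor [k]. *)
have qxy : q x y <= k * c.
  case: s1 sE le1 lt1 cE c1 qu sn => [|a s1] sE le1 lt1 cE c1 qu sn.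
    exact: le_trans qu kcc.
  apply: (le_trans (q_ultra x (last x (a :: s1)) y)).
  rewrite ler_pM2l ?(lt_le_trans _ k1)// ge_max qu andbT.
  by apply: (le_trans (IH (a :: s1) _ x isT)) => /=;
    [move: sn => /=; lia|move: le1 => /=; lra].
rewrite last_cat /=.
(* Attaching the remaining part costs a second factor [k]; this is where [k * k <= 2] enters. *)
have c22 : k * (k * c) <= 2 * c by rewrite mulrA ler_pM2r.
case: s2 sE c2 cE sn => [|a s2] sE c2 cE sn.
  apply: (le_trans qxy); apply: le_trans c22.
  by rewrite ler_pM2l ?(lt_le_trans _ k1).
apply: (le_trans (q_ultra x y _)); apply: le_trans c22.
rewrite ler_pM2l ?(lt_le_trans _ k1)// ge_max qxy /=; apply: le_trans kcc.
apply: (le_trans (IH (a :: s2) _ y isT)); first by move: sn => /=; lia.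
lra.
Qed.

Definition chain_dist x y : R := inf (range (fun s => chain_sum x (rcons s y))).

Lemma has_inf_chain x y : has_inf (range (fun s => chain_sum x (rcons s y))).
Proof.
split; first by exists (chain_sum x [:: y]), [::].
by exists 0 => _ [s _ <-]; exact: chain_sum_ge0.
Qed.

Lemma chain_dist_le x y : chain_dist x y <= q x y.
Proof.
apply: ge_inf; first by have [] := has_inf_chain x y.
by exists [::] => //=; rewrite addr0.
Qed.

Lemma chain_dist_ge x y : q x y / 2 <= chain_dist x y.
Proof.
apply: lb_le_inf; first by have [] := has_inf_chain x y.
move=> _ [s _ <-]; rewrite ler_pdivrMr// mulrC.
by have := @frink x (rcons s y); rewrite last_rcons size_rcons; apply.
Qed.

Lemma chain_dist_triangle x y z :
  chain_dist x z <= chain_dist x y + chain_dist y z.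
Proof.
apply/ler_addgt0Pr => e e0.
have e20 : 0 < e / 2 by rewrite divr_gt0.
have [_ [s _ <-] hs] := inf_adherent e20 (has_inf_chain x y).
have [_ [t _ <-] ht] := inf_adherent e20 (has_inf_chain y z).
apply: (@le_trans _ _ (chain_sum x (rcons (rcons s y ++ t) z))).
  apply: ge_inf; first by case: (has_inf_chain x z).
  by exists (rcons s y ++ t).
rewrite rcons_cat chain_sum_cat last_rcons.
by rewrite /chain_dist; move: hs ht; lra.
Qed.

End Frink.

(** * Finite sums: supports, level sets, geometric series *)

Section SumLemmas.
Variable R : realType.

Lemma eq_sum_support (T : eqType) (X Y : seq T) (F : T -> R) :
  uniq X -> uniq Y -> (forall z, F z != 0 -> z \in X) ->
  (forall z, F z != 0 -> z \in Y) -> \sum_(z <- X) F z = \sum_(z <- Y) F z.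
Proof.
have drop0 (Z : seq T) : \sum_(z <- Z) F z = \sum_(z <- Z | F z != 0) F z.
  by rewrite [RHS]big_mkcond /=; apply: eq_bigr => z _; case: eqP.
move=> uX uY FX FY; rewrite drop0 [RHS]drop0 -big_filter -[RHS]big_filter.
apply: perm_big; apply: uniq_perm; rewrite ?filter_uniq// => z.
by rewrite !mem_filter; have [Fz|] := boolP (F z != 0); rewrite //= FX ?FY.
Qed.

Lemma ler_sum_subset (T : eqType) (X Y : seq T) (F : T -> R) :
  uniq X -> uniq Y -> {subset X <= Y} -> (forall z, 0 <= F z) ->
  \sum_(z <- X) F z <= \sum_(z <- Y) F z.
Proof.
move=> uX uY XY F0; rewrite [leRHS](bigID (mem X)) /=.
rewrite -[leLHS]addr0 lerD ?sumr_ge0// -[leRHS]big_filter.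
suff YX : perm_eq X [seq z <- Y | z \in X] by rewrite (perm_big _ YX).
apply: uniq_perm; rewrite ?filter_uniq// => z; rewrite mem_filter.
by have [/XY ->|] := boolP (z \in X).
Qed.

(** Turns a count per level into a numerical series; [X] meets finitely many levels, so a finite [J]
    is enough. *)
Lemma ler_sum_levels (T : eqType) (X : seq T) (l : T -> nat) (F B : nat -> R) :
  (forall j, 0 <= F j) ->
  (forall j, (count (fun z => l z == j) X)%:R <= B j) ->
  exists J, \sum_(z <- X) F (l z) <= \sum_(j < J) B j * F j.
Proof.
move=> F0 cB; exists (\max_(z <- X) l z).+1; set J := _.+1.
have FE z : z \in X -> F (l z) = \sum_(j < J) (l z == j)%:R * F j.
  move=> zX; have zJ : (l z < J)%N by rewrite ltnS; exact: leq_bigmax_seq.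
  rewrite (bigD1 (Ordinal zJ))//= eqxx mul1r big1 ?addr0// => j.
  by rewrite -val_eqE eq_sym /= => /negPf ->; rewrite mul0r.
rewrite big_seq (eq_bigr _ FE) -big_seq exchange_big /=.
apply: ler_sum => j _; rewrite -mulr_suml ler_wpM2r//.
apply: le_trans (cB j); rewrite -sum1_count natr_sum [leRHS]big_mkcond /=.
by apply: ler_sum => z _; case: eqP.
Qed.

Lemma ler_sum_geometric (a : R) n : 0 <= a < 1 -> \sum_(j < n) a ^+ j <= (1 - a)^-1.
Proof.
move=> /andP[a0 a1]; have a10 : 0 < 1 - a by rewrite subr_gt0.
rewrite -(ler_pM2l a10) divff ?gt_eqF// -opprB mulNr -subrX1 opprB.
by rewrite gerBl exprn_ge0.
Qed.

Lemma expR_natM (b : R) n : expR (- (b * n%:R)) = expR (- b) ^+ n.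
Proof. by rewrite -expRM_natr mulNr. Qed.

End SumLemmas.

(** * The word metric and its Gromov products *)

Section WordDist.
Variables (R : realType) (G : groupType) (S : {fset G}).
Hypothesis genS : generates S.
Local Notation dn := (word_dist genS).
Local Notation d x y := ((dn x y)%:R : R).
Local Notation gp := (gromov_product genS R).
Implicit Types (g o x y z : G).

Lemma word_dist1 x : dn 1%g x = word_length genS x.
Proof. by rewrite /word_dist invg1 mul1g. Qed.

Lemma word_distxx x : dn x x = 0%N.
Proof. by rewrite /word_dist mulVg word_length1. Qed.

Lemma word_distC x y : dn x y = dn y x.
Proof. by rewrite /word_dist -word_lengthV invgM invgK. Qed.

Lemma word_dist_triangle x y z : (dn x z <= dn x y + dn y z)%N.
Proof.
rewrite /word_dist; have := word_lengthM genS (x^-1 * y)%g (y^-1 * z)%g.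
by rewrite -mulgA mulVKg.
Qed.

Lemma word_distM g x y : dn (g * x)%g (g * y)%g = dn x y.
Proof. by rewrite /word_dist invgM -mulgA mulKg. Qed.

Lemma word_dist_mulr x y : dn x (x * y)%g = word_length genS y.
Proof. by rewrite /word_dist mulKg. Qed.

Lemma word_dist_triangleR x y z : d x z <= d x y + d y z.
Proof. by rewrite -natrD ler_nat word_dist_triangle. Qed.

Lemma gromov_productE o x y : gp o x y = (d o x + d o y - d x y) / 2.
Proof. by rewrite /gromov_product !(word_distC _ o). Qed.

Lemma gromov_productC o x y : gp o x y = gp o y x.
Proof. by rewrite !gromov_productE (word_distC x y) (addrC (d o x)). Qed.

Lemma gromov_productM g o x y : gp (g * o)%g (g * x)%g (g * y)%g = gp o x y.
Proof. by rewrite /gromov_product !word_distM. Qed.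

Lemma gromov_product_ge0 o x y : 0 <= gp o x y.
Proof.
have := word_dist_triangleR x o y; rewrite gromov_productE (word_distC x o); lra.
Qed.

Lemma gromov_product_lel o x y : gp o x y <= d o x.
Proof.
have := word_dist_triangleR o x y; rewrite gromov_productE; lra.
Qed.

Lemma gromov_product_add o x y : gp o x y + gp x o y = d o x.
Proof. by rewrite !gromov_productE (word_distC x o); field. Qed.

Lemma gromov_productxx o x : gp o x x = d o x.
Proof. by rewrite gromov_productE word_distxx; field. Qed.

End WordDist.

(** * Visual gauges and the invariant kernel *)

Section Hyperbolic.
Variables (R : realType) (G : groupType) (S : {fset G}).
Hypothesis genS : generates S.
Local Notation dn := (word_dist genS).
Local Notation d x y := ((dn x y)%:R : R).
Local Notation gp := (gromov_product genS R).
Implicit Types (g o a x y z : G).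

Variable delta : R.
Hypothesis hyp : forall o x y z,
  Num.min (gp o x y) (gp o y z) - delta <= gp o x z.

Lemma delta_ge0 : 0 <= delta.
Proof.
by have := hyp 1%g 1%g 1%g 1%g; rewrite gromov_productxx word_distxx minxx; lra.
Qed.

(* Small enough for [exp (eps * delta) ^ 2 <= 2], as Frink's lemma requires. *)
Definition visual_rate : R := ln 2 / (2 * (delta + 1)).
Local Notation eps := visual_rate.

Lemma visual_rate_gt0 : 0 < eps.
Proof.
have := delta_ge0; rewrite /visual_rate => ?; rewrite divr_gt0 ?ln_gt0 ?ltr1n//; lra.
Qed.

Definition visual_gauge o x y : R := expR (- (eps * gp o x y)).
Local Notation q := visual_gauge.

Lemma visual_gauge_gt0 o x y : 0 < q o x y.
Proof. exact: expR_gt0. Qed.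

Lemma visual_gaugeC o x y : q o x y = q o y x.
Proof. by rewrite /q gromov_productC. Qed.

Lemma visual_gaugeM g o x y : q (g * o)%g (g * x)%g (g * y)%g = q o x y.
Proof. by rewrite /q gromov_productM. Qed.

Lemma visual_gauge_le (c : R) o x y : c <= gp o x y -> q o x y <= expR (- (eps * c)).
Proof. by move=> ?; rewrite ler_expR lerN2 ler_pM2l// visual_rate_gt0. Qed.

Lemma visual_gauge_ultra o x y z :
  q o x z <= expR (eps * delta) * Num.max (q o x y) (q o y z).
Proof.
have e0 := visual_rate_gt0.
have key (c : R) : c - delta <= gp o x z ->
    q o x z <= expR (eps * delta) * expR (- (eps * c)).
  by move=> /visual_gauge_le; rewrite mulrBr opprB expRD.
have := hyp o x y z; rewrite minEle maxEle /q ler_expR lerN2 ler_pM2l//.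
have [xy|yx] := leP (gp o x y) (gp o y z).
  have [yx /key//|_ /key//] := leP (gp o y z) (gp o x y).
  by have -> : gp o x y = gp o y z by apply/le_anti/andP.
by rewrite (ltW yx) => /key.
Qed.

Lemma visual_const_ge1 : 1 <= expR (eps * delta).
Proof.
have := delta_ge0; have := visual_rate_gt0 => ? ?.
by rewrite -expR0 ler_expR mulr_ge0// ltW.
Qed.

Lemma visual_const_sqr : expR (eps * delta) * expR (eps * delta) <= 2.
Proof.
have := delta_ge0 => ?; rewrite -expRD -[leRHS](@lnK R) ?posrE//.
rewrite ler_expR /visual_rate -mulr2n -[leLHS]mulr_natr.
have -> : ln 2 / (2 * (delta + 1)) * delta * 2 = ln 2 * (delta / (delta + 1)) :> R.
  by field; rewrite gt_eqF//; lra.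
by rewrite ler_piMr ?ln_ge0 ?ler1n// ler_pdivrMr ?mul1r; lra.
Qed.

(** Transported to the base point [1], so that a single gauge is involved and invariance under the
    group holds by construction. *)
Definition visual_dist z x y : R := chain_dist (q 1%g) (z^-1 * x)%g (z^-1 * y)%g.
Local Notation rho := visual_dist.

Lemma visual_gauge1 z x y : q 1%g (z^-1 * x)%g (z^-1 * y)%g = q z x y.
Proof. by rewrite -(visual_gaugeM z) mulg1 !mulVKg. Qed.

Lemma visual_dist_le z x y : rho z x y <= q z x y.
Proof.
by rewrite -visual_gauge1; apply: chain_dist_le; exact: visual_gauge_gt0.
Qed.

Lemma visual_dist_ge z x y : q z x y / 2 <= rho z x y.
Proof.
rewrite -visual_gauge1; apply: (@chain_dist_ge _ _ _ (expR (eps * delta))).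
- exact: visual_gauge_gt0.
- exact: visual_const_ge1.
- exact: visual_const_sqr.
- exact: visual_gauge_ultra.
Qed.

Lemma visual_dist_triangle z x y t : rho z x t <= rho z x y + rho z y t.
Proof. by apply: chain_dist_triangle; exact: visual_gauge_gt0. Qed.

(* Truncating at 1/4, below the value 1/2 guaranteed on geodesics, makes the sum
   [smooth_dist] finite. *)
Definition between z a x : R := Num.max 0 (rho z a x - 4^-1).
Local Notation chi := between.

Lemma between_ge0 z a x : 0 <= chi z a x.
Proof. by rewrite /chi le_max lexx. Qed.

Lemma betweenM g z a x : chi (g * z)%g (g * a)%g (g * x)%g = chi z a x.
Proof. by rewrite /chi /rho !invgM -!mulgA !mulKg. Qed.

Lemma between_le z a x : chi z a x <= q z a x.
Proof.
rewrite /chi ge_max ltW ?visual_gauge_gt0//=.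
by have := visual_dist_le z a x; lra.
Qed.

Lemma between_lipr z a x y : chi z a x <= chi z a y + q z x y.
Proof.
have := visual_dist_triangle z a y x; have := visual_dist_le z y x.
have := visual_gauge_gt0 z x y; rewrite (visual_gaugeC z y x) => ? ? ?.
by rewrite /chi ge_max; apply/andP; split;
  case: (leP 0 (rho z a y - 4^-1)) => ?; lra.
Qed.

Lemma between_lipl z a b x : chi z a x <= chi z b x + q z a b.
Proof.
have := visual_dist_triangle z a b x; have := visual_dist_le z a b.
have := visual_gauge_gt0 z a b => ? ? ?.
by rewrite /chi ge_max; apply/andP; split;
  case: (leP 0 (rho z b x - 4^-1)) => ?; lra.
Qed.

(** The value of the Gromov product at which the gauge drops to 1/4, the truncation level of
    [between]. *)
Definition between_radius : R := ln 4 / eps.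

Lemma between_radius_ge0 : 0 <= between_radius.
Proof. by rewrite divr_ge0 ?ln_ge0 ?ler1n// ltW// visual_rate_gt0. Qed.

Lemma between_near z a x : chi z a x != 0 -> gp z a x <= between_radius.
Proof.
move=> chi0; rewrite leNgt; apply: contra_neqN chi0 => far.
apply/eqP; rewrite eq_le between_ge0 andbT /chi ge_max lexx /= subr_le0.
apply: (le_trans (visual_dist_le _ _ _)).
apply: (le_trans (visual_gauge_le (ltW far))).
rewrite /between_radius mulrCA divff ?mulr1 ?gt_eqF ?visual_rate_gt0//.
by rewrite expRN lnK ?posrE.
Qed.

Lemma between_geodesic z a x : gp z a x = 0 -> 4^-1 <= chi z a x.
Proof.
move=> gp0; have := visual_dist_ge z a x.
by rewrite /q gp0 mulr0 oppr0 expR0 /chi le_max => ?; apply/orP; right; lra.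
Qed.

(** A ball around [a]: if the Gromov product of [a] and [x] at [z] is at most [between_radius], then
    [d a z <= d a x + 2 * between_radius]. *)
Definition between_support a x : seq G :=
  undup [seq (a * y)%g |
    y <- word_ball S (Num.truncn (d a x + 2 * between_radius))].

Lemma between_support_uniq a x : uniq (between_support a x).
Proof. exact: undup_uniq. Qed.

Lemma between_supportP z a x : chi z a x != 0 -> z \in between_support a x.
Proof.
move=> /between_near near; rewrite mem_undup; apply/mapP.
exists (a^-1 * z)%g; last by rewrite mulVKg.
apply: (mem_word_ball (genS := genS)); rewrite -[word_length _ _]/(dn a z).
have leR : d a z <= d a x + 2 * between_radius.
  have : 0 <= d z x by [].
  by move: near; rewrite gromov_productE (word_distC genS z a); lra.
by rewrite truncn_ge_nat// addr_ge0// mulr_ge0// between_radius_ge0.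
Qed.

Definition smooth_dist a x : R := \sum_(z <- between_support a x) chi z a x.
Local Notation N := smooth_dist.

Lemma smooth_distE X a x : uniq X -> {subset between_support a x <= X} ->
  N a x = \sum_(z <- X) chi z a x.
Proof.
move=> uX sX; apply: eq_sum_support => //; first exact: between_support_uniq.
- by move=> z; exact: between_supportP.
- by move=> z /between_supportP /sX.
Qed.

Lemma smooth_distM g a x : N (g * a)%g (g * x)%g = N a x.
Proof.
pose X := [seq (g * z)%g | z <- between_support a x].
have -> : N (g * a)%g (g * x)%g = \sum_(z <- X) chi z (g * a)%g (g * x)%g.
  apply: eq_sum_support; rewrite ?between_support_uniq//.
  - by rewrite map_inj_uniq ?between_support_uniq//; exact: mulgI.
  - by move=> z /between_supportP.
  - move=> z chi0; apply/mapP; exists (g^-1 * z)%g; last by rewrite mulVKg.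
    by apply: between_supportP; rewrite -(betweenM g) mulVKg.
by rewrite big_map; apply: eq_bigr => z _; rewrite betweenM.
Qed.

(** A geodesic from [a] to [x] has [dn a x + 1] vertices, and each contributes at least 1/4. *)
Lemma smooth_dist_ge a x : d a x / 4 <= N a x.
Proof.
have [t [t0 tl _ tlen]] := geodesic genS (a^-1 * x)%g.
rewrite -/(dn a x) in tl tlen.
pose X := [seq (a * t i)%g | i <- iota 0 (dn a x).+1].
have uX : uniq X.
  rewrite map_inj_in_uniq ?iota_uniq// => i j.
  rewrite !mem_iota /= !add0n !ltnS => il jl /mulgI tij.
  by have [<- _] := tlen i il; have [<- _] := tlen j jl; rewrite tij.
apply: (@le_trans _ _ (\sum_(z <- X) chi z a x)).
  apply: (@le_trans _ _ (\sum_(z <- X) 4^-1)); last first.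
    rewrite !big_map !big_seq; apply: ler_sum => i; rewrite mem_iota /= add0n ltnS => il.
    have [ti txi] := tlen i il.
    apply: between_geodesic; rewrite gromov_productE.
    rewrite [dn (a * t i)%g a]word_distC word_dist_mulr ti.
    have -> : dn (a * t i)%g x = (dn a x - i)%N.
      by rewrite -txi /word_dist invgM !mulgA.
    by rewrite natrB//; lra.
  rewrite big_const_seq count_predT iter_addr addr0 size_map size_iota.
  by rewrite -[leRHS]mulr_natl ler_pM2r ?invr_gt0// ler_nat.
pose Y := undup (X ++ between_support a x).
rewrite (@smooth_distE Y) ?undup_uniq//; last first.
  by move=> z zX; rewrite mem_undup mem_cat zX orbT.
apply: ler_sum_subset; rewrite ?undup_uniq//; last exact: (fun z => between_ge0 z a x).
by move=> z zX; rewrite mem_undup mem_cat zX.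
Qed.

End Hyperbolic.

(** * Decay of mixed differences and almost additivity of the kernel *)

Section SmoothDist.
Variables (R : realType) (G : groupType) (S : {fset G}).
Hypothesis genS : generates S.
Local Notation dn := (word_dist genS).
Local Notation d x y := ((dn x y)%:R : R).
Local Notation gp := (gromov_product genS R).
Implicit Types (g o a x y z : G).
Variable delta : R.
Hypothesis hyp : forall o x y z,
  Num.min (gp o x y) (gp o y z) - delta <= gp o x z.
Local Notation eps := (visual_rate delta).
Local Notation q := (visual_gauge genS delta).
Local Notation chi := (between genS delta).
Local Notation K0 := (between_radius delta).
Local Notation N := (smooth_dist genS delta).

Lemma expR_rate (b : R) : 0 < b -> 0 <= expR (- b) < 1.
Proof. by move=> b0; rewrite expR_ge0 /= -[ltRHS]expR0 ltr_expR oppr_lt0. Qed.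

(** Two points near a geodesic from [o] to [x] and at equal distance from [o] are at most
    [2 * K + 2 * delta] apart by hyperbolicity. Each level thus has boundedly many points, and a
    geometric series remains. *)
Lemma sum_near_exp (K b : R) : 0 < b -> exists2 C : R, 0 <= C &
  forall o x (X : seq G), uniq X ->
    \sum_(z <- X | gp z o x <= K) expR (- (b * d o z)) <= C.
Proof.
move=> b0; have e01 := expR_rate b0.
pose n := (Num.truncn (2 * K + 2 * delta)).+1.
pose B := size (word_ball S n).
have C0 : 0 <= (1 - expR (- b))^-1.
  by rewrite invr_ge0 subr_ge0; case/andP: e01 => _ /ltW.
exists (B%:R * (1 - expR (- b))^-1); first by rewrite mulr_ge0.
move=> o x X uX; rewrite -big_filter; set Y := [seq z <- X | gp z o x <= K].
have cY j : (count (fun z => dn o z == j) Y <= B)%N.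
  rewrite -size_filter; case ZE : [seq z <- Y | dn o z == j] => [//|z0 Z0].
  rewrite -ZE {}/B -[leqRHS](size_map (fun y => z0 * y)%g).
  have : z0 \in [seq z <- Y | dn o z == j] by rewrite ZE mem_head.
  rewrite !mem_filter => /andP[/eqP z0j /andP[near0 _]].
  apply: uniq_leq_size; first exact/filter_uniq/filter_uniq/uX.
  move=> z; rewrite !mem_filter => /andP[/eqP zj /andP[near _]].
  apply/mapP; exists (z0^-1 * z)%g; last by rewrite mulVKg.
  apply: (mem_word_ball (genS := genS)); rewrite -[word_length _ _]/(dn z0 z).
  rewrite -ltnS -(ltr_nat R); apply: le_lt_trans (_ : 2 * K + 2 * delta < _); last first.
    by apply: (lt_trans (truncnS_gt _)); rewrite ltr_nat.
  have := hyp o z0 x z.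
  have := gromov_product_add R genS o z x; have := gromov_product_add R genS o z0 x.
  rewrite zj z0j => g0 g1.
  have gE : gp o z0 z = j%:R - d z0 z / 2.
    by rewrite gromov_productE zj z0j; lra.
  rewrite gE (gromov_productC _ _ o x z) minEle; case: ifP => _; lra.
pose F (j : nat) := expR (- (b * j%:R)) : R.
have [j|j|J] := @ler_sum_levels R _ Y (dn o) F (fun=> B%:R).
- exact: expR_ge0.
- by rewrite ler_nat.
move=> /le_trans; apply.
rewrite -mulr_sumr ler_wpM2l//.
by under eq_bigr do rewrite /F expR_natM; exact: ler_sum_geometric.
Qed.

Let near_weight (b : R) c u z : R :=
  if gp z c u <= K0 then expR (- (b * d c z)) else 0.

Let near_weight_ge0 b c u z : 0 <= near_weight b c u z.
Proof. by rewrite /near_weight; case: ifP => // _; exact: expR_ge0. Qed.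

Let near_weightE b c u z : chi z c u != 0 ->
  near_weight b c u z = expR (- (b * d c z)).
Proof. by move=> /(between_near hyp); rewrite /near_weight => ->. Qed.

(* The two bounds on a summand combine through
   [max(d z x, d z a) >= d a x / 4 + d a z / 2]. *)
Lemma smooth_dist_holder (M L : R) : exists2 C : R, 0 <= C &
  forall a b x y, d a b <= M -> d x y <= L ->
    `|N a x - N b x - (N a y - N b y)| <= C * expR (- (eps / 4 * d a x)).
Proof.
have e0 := visual_rate_gt0 hyp.
have e20 : 0 < eps / 2 by rewrite divr_gt0.
have [C C0 sumC] := sum_near_exp K0 e20.
(* The bound [far] uses [|L| + |M|]; the second [|M|] pays for moving the base of the weight from
   [a] to [b] in [Tb]. *)
pose E := 2 * expR (eps * (`|L| + 2 * `|M|)).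
have E0 : 0 <= E by rewrite mulr_ge0// expR_ge0.
exists (4 * E * C); first by rewrite !mulr_ge0.
move=> a b x y abM xyL.
have {}abM : d a b <= `|M| := le_trans abM (ler_norm _).
have {}xyL : d x y <= `|L| := le_trans xyL (ler_norm _).
pose X := undup (between_support genS delta a x ++ between_support genS delta b x ++
  between_support genS delta a y ++ between_support genS delta b y).
have uX : uniq X by exact: undup_uniq.
have NE c u : {subset between_support genS delta c u <= X} ->
    N c u = \sum_(z <- X) chi z c u by move=> sX; apply: smooth_distE.
rewrite !NE; try by move=> z zX; rewrite mem_undup !mem_cat zX ?orbT.
rewrite -!sumrB; set f := expR (- (eps / 4 * _)).
pose w c u z := near_weight (eps / 2) c u z.
apply: (@le_trans _ _ (\sum_(z <- X)
    E * f * (w a x z + w b x z + w a y z + w b y z))); last first.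
  rewrite -mulr_sumr !big_split /=.
  have sumw c u : \sum_(z <- X) w c u z <= C.
    by rewrite -big_mkcond; exact: sumC.
  have := sumw a x; have := sumw b x; have := sumw a y; have := sumw b y.
  move=> ? ? ? ?; have -> : 4 * E * C * f = E * f * (C + C + C + C) by ring.
  by rewrite ler_wpM2l ?mulr_ge0 ?expR_ge0//; lra.
apply: le_trans (ler_norm_sum _ _ _) _; apply: ler_sum => z _.
set T := _ - _.
have T1 : `|T| <= 2 * q z x y.
  have := between_lipr genS delta z a x y; have := between_lipr genS delta z a y x.
  have := between_lipr genS delta z b x y; have := between_lipr genS delta z b y x.
  rewrite (visual_gaugeC _ _ z y x) /T => ? ? ? ?.
  by rewrite ler_norml; apply/andP; split; lra.
have T2 : `|T| <= 2 * q z a b.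
  have := between_lipl genS delta z a b x; have := between_lipl genS delta z b a x.
  have := between_lipl genS delta z a b y; have := between_lipl genS delta z b a y.
  rewrite (visual_gaugeC _ _ z b a) /T => ? ? ? ?.
  by rewrite ler_norml; apply/andP; split; lra.
have far : `|T| <= 2 * expR (- (eps * (d a x / 4 + d a z / 2 - `|L| - `|M|))).
  have tri := word_dist_triangleR R genS a z x.
  have M0 := normr_ge0 M; have L0 := normr_ge0 L.
  have [lt|le] := leP (d z x) (d z a).
    apply: (le_trans T2); rewrite ler_pM2l//.
    apply: (visual_gauge_le hyp); rewrite gromov_productE.
    have := word_dist_triangleR R genS z b a.
    by move: lt tri; rewrite !(word_distC genS _ a); lra.
  apply: (le_trans T1); rewrite ler_pM2l//.
  apply: (visual_gauge_le hyp); rewrite gromov_productE.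
  have := word_dist_triangleR R genS z y x.
  by move: le tri; rewrite (word_distC genS z a) (word_distC genS y x); lra.
have EfE (s : R) : E * f * expR s =
    2 * expR (eps * (`|L| + 2 * `|M|) + - (eps / 4 * d a x) + s).
  by rewrite /E /f !expRD !mulrA.
have Ta : `|T| <= E * f * expR (- (eps / 2 * d a z)).
  apply: (le_trans far); rewrite EfE ler_pM2l// ler_expR.
  by have := mulr_ge0 (ltW e0) (normr_ge0 M); lra.
have Tb : `|T| <= E * f * expR (- (eps / 2 * d b z)).
  apply: (le_trans far); rewrite EfE ler_pM2l// ler_expR.
  have tri := word_dist_triangleR R genS b a z; rewrite (word_distC genS b a) in tri.
  have : 0 <= eps * (d a b + d a z - d b z) by rewrite mulr_ge0 ?(ltW e0)//; lra.
  have := mulr_ge0 (ltW e0) (normr_ge0 M).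
  have : 0 <= eps * (`|M| - d a b) by rewrite mulr_ge0 ?(ltW e0)//; lra.
  lra.
have w0 c u : 0 <= w c u z by exact: near_weight_ge0.
have Ef0 : 0 <= E * f by rewrite mulr_ge0// expR_ge0.
have [T0|Tn0] := eqVneq T 0.
  by rewrite T0 normr0 mulr_ge0// !addr_ge0.
have wE c u : chi z c u != 0 -> w c u z = expR (- (eps / 2 * d c z)).
  exact: near_weightE.
have mono (s t : R) : `|T| <= E * f * s -> s <= t -> `|T| <= E * f * t.
  by move=> Ts st; apply: (le_trans Ts); rewrite ler_wpM2l.
have := w0 a x; have := w0 b x; have := w0 a y; have := w0 b y => h1 h2 h3 h4.
(* If [T] is nonzero, one of its four terms is, and the weight attached to that term already
   dominates [T]. *)
have [c1|/wE e1] := eqVneq (chi z a x) 0; last by apply: (mono _ _ Ta); rewrite -e1; lra.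
have [c2|/wE e2] := eqVneq (chi z b x) 0; last by apply: (mono _ _ Tb); rewrite -e2; lra.
have [c3|/wE e3] := eqVneq (chi z a y) 0; last by apply: (mono _ _ Ta); rewrite -e3; lra.
have [c4|/wE e4] := eqVneq (chi z b y) 0; last by apply: (mono _ _ Tb); rewrite -e4; lra.
by case/eqP: Tn0; rewrite /T c1 c2 c3 c4; lra.
Qed.

(** Each defect [T] is at most twice the gauge of [o, x] and of [o, a] at [z]. Since [a] and [x]
    diverge at [o], [z] cannot follow both of them from [o], so one of these gauges is exponentially
    small in [d o z]. A positive [T] also forces [z] near a geodesic from [o] to [x] or to [a], and
    [sum_near_exp] applies. *)
Lemma smooth_dist_add (K : R) : exists2 C : R, 0 <= C &
  forall o a x, gp o a x <= K -> N a o + N o x - C <= N a x.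
Proof.
have e0 := visual_rate_gt0 hyp.
have [C C0 sumC] := sum_near_exp K0 e0.
pose E := 2 * expR (eps * (K + delta)).
have E0 : 0 <= E by rewrite mulr_ge0// expR_ge0.
exists (2 * E * C); first by rewrite !mulr_ge0.
move=> o a x axK.
pose X := undup (between_support genS delta a x ++ between_support genS delta a o ++
  between_support genS delta o x).
have uX : uniq X by exact: undup_uniq.
have NE c u : {subset between_support genS delta c u <= X} ->
    N c u = \sum_(z <- X) chi z c u by move=> sX; apply: smooth_distE.
rewrite !NE; try by move=> z zX; rewrite mem_undup !mem_cat zX ?orbT.
pose w u z := near_weight eps o u z.
suff : \sum_(z <- X) (chi z a o + chi z o x - chi z a x) <=
    \sum_(z <- X) E * (w x z + w a z).
  rewrite -mulr_sumr !big_split /= sumrN.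
  have sumw u : \sum_(z <- X) w u z <= C.
    by rewrite -big_mkcond; exact: sumC.
  have := sumw x; have := sumw a => wa wx.
  have : E * (\sum_(z <- X) w x z + \sum_(z <- X) w a z) <= E * (C + C).
    by rewrite ler_wpM2l//; lra.
  have -> : E * (C + C) = 2 * E * C by ring.
  lra.
apply: ler_sum => z _; set T := _ - _.
have T1 : T <= 2 * q z o x.
  have := between_lipr genS delta z a o x.
  by have := between_le genS delta z o x; rewrite /T; lra.
have T2 : T <= 2 * q z o a.
  have := between_lipl genS delta z o a x; have := between_le genS delta z a o.
  by rewrite (visual_gaugeC _ _ z a o) /T; lra.
have far : T <= E * expR (- (eps * d o z)).
  rewrite /E -mulrA -expRD -mulrN -mulrDr -[_ - _]opprB mulrN.
  have := hyp o a z x; rewrite minEle; case: ifP => _ az.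
    apply: (le_trans T2); rewrite ler_pM2l//; apply: (visual_gauge_le hyp).
    have := gromov_product_add R genS o z a.
    by rewrite (gromov_productC _ _ o z a); lra.
  apply: (le_trans T1); rewrite ler_pM2l//; apply: (visual_gauge_le hyp).
  by have := gromov_product_add R genS o z x; lra.
have w0 u : 0 <= w u z by exact: near_weight_ge0.
have := w0 x; have := w0 a => wa wx.
have mono (t : R) : expR (- (eps * d o z)) <= t -> T <= E * t.
  by move=> st; apply: (le_trans far); rewrite ler_wpM2l.
have [c1|/(near_weightE eps) e1] := eqVneq (chi z o x) 0; last first.
  by apply: mono; rewrite -e1 -/(w x z); lra.
have [c2|c2] := eqVneq (chi z a o) 0; last first.
  apply: mono; rewrite /w /near_weight (gromov_productC _ _ z o a).
  by rewrite (between_near hyp c2); move: wx; rewrite /w /near_weight; lra.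
apply: (@le_trans _ _ 0); last by rewrite mulr_ge0// addr_ge0.
by rewrite /T c1 c2 addr0 sub0r oppr_le0 between_ge0.
Qed.

End SmoothDist.

(** * Cancellation in products and loxodromic elements *)

Section FreeSemigroup.
Variables (R : realType) (G : groupType) (S : {fset G}).
Hypothesis genS : generates S.
Local Notation len := (word_length genS).
Local Notation l x := ((len x)%:R : R).
Local Notation ip x y := (gromov_product genS R 1%g x y).
Implicit Types (a f g h x y : G) (s : seq G).
Variable delta : R.
Hypothesis hyp : forall o x y z,
  Num.min (gromov_product genS R o x y) (gromov_product genS R o y z) - delta
    <= gromov_product genS R o x z.

Lemma gp1_hyp x y z (c : R) : ip x z <= c ->
  ip x y <= c + delta \/ ip y z <= c + delta.
Proof.
by have := hyp 1%g x y z; rewrite minEle; case: ifP => _ ? ?; [left|right]; lra.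
Qed.

Lemma gp1_min y x z (c : R) : c <= ip x y -> c <= ip y z -> c - delta <= ip x z.
Proof. by have := hyp 1%g x y z; rewrite minEle; case: ifP => _; lra. Qed.

Lemma gp1E x y : ip x y = (l x + l y - l (x^-1 * y)%g) / 2.
Proof. by rewrite gromov_productE !word_dist1. Qed.

Lemma gp1C x y : ip x y = ip y x.
Proof. exact: gromov_productC. Qed.

Lemma gp1xx x : ip x x = l x.
Proof. by rewrite gromov_productxx word_dist1. Qed.

Lemma gp1_ge0 x y : 0 <= ip x y.
Proof. exact: gromov_product_ge0. Qed.

Lemma gp1_lel x y : ip x y <= l x.
Proof. by rewrite -(word_dist1 genS) gromov_product_lel. Qed.

Lemma gp1_ler x y : ip x y <= l y.
Proof. by rewrite gp1C gp1_lel. Qed.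

(** The Gromov product of [x^-1] and [y] measures the cancellation in the product [x * y]. *)
Lemma word_lengthME x y : l (x * y)%g = l x + l y - 2 * ip x^-1%g y.
Proof. by rewrite gp1E invgK word_lengthV; field. Qed.

Lemma gp1_mul x y : ip x (x * y)%g = l x - ip x^-1%g y.
Proof. by rewrite !gp1E mulKg word_lengthME gp1E invgK word_lengthV; field. Qed.

Lemma gp1_mulr_le x h y : ip (x * h)%g y <= ip x y + l h.
Proof.
rewrite !gp1E.
have : l (x * h)%g <= l x + l h by rewrite -natrD ler_nat word_lengthM.
have : l (x^-1 * y)%g <= l h + l ((x * h)^-1 * y)%g.
  rewrite -natrD ler_nat; apply: leq_trans (word_lengthM _ _ _).
  by rewrite invgM !mulgA mulgV mul1g.
lra.
Qed.

Lemma gp1_mull_le h x y : ip (h * x)%g (h * y)%g <= l h + ip x y.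
Proof.
rewrite !gp1E invgM -mulgA mulKg.
have : l (h * x)%g <= l h + l x by rewrite -natrD ler_nat word_lengthM.
have : l (h * y)%g <= l h + l y by rewrite -natrD ler_nat word_lengthM.
lra.
Qed.

(* A product whose consecutive factors cancel little compared with their
   lengths behaves as a local-to-global quasi-geodesic. *)
Lemma long_product (K : R) f s : 0 <= K ->
  path (fun x y => ip x^-1%g y <= K) f s ->
  all (fun x => 2 * K + 2 * delta + 1 <= l x) (f :: s) ->
  l f - K - delta <= ip f (\prod_(x <- f :: s) x)%g /\
  (size (f :: s))%:R <= l (\prod_(x <- f :: s) x)%g.
Proof.
have delta0 := delta_ge0 hyp.
move=> K0; elim: s f => [|g s IH] f /=.
  move=> _ /andP[lf _]; rewrite big_seq1 gp1xx; split; first lra.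
  by apply: (le_trans _ lf); rewrite -[leLHS]add0r lerD2r; lra.
move=> /andP[fg gs] /andP[lf /[dup] ls /andP[lg _]]; have [IH1 IH2] := IH g gs ls.
rewrite big_cons; set P := (\prod_(x <- g :: s) x)%g in IH1 IH2 *.
(* By induction [P] follows [g] for longer than [K + delta], so if [f^-1] followed [P] that far it
   would follow [g] beyond [K]. *)
have fP : ip f^-1%g P <= K + delta.
  by case: (gp1_hyp P fg) => //; rewrite (gp1C P); lra.
rewrite gp1_mul word_lengthME; split; first lra.
by move: IH2; rewrite /= -[(size s).+2%:R]natr1; lra.
Qed.

(* Two long elements with no cancellation between them: if neither is
   loxodromic, then each is a conjugate of a short element by about half of
   itself, so their product is loxodromic. *)
Lemma exists_loxodromic (C : R) : 0 <= C -> (forall n, exists x, (n <= len x)%N) ->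
  exists a, 2 * ip a^-1%g a + C <= l a.
Proof.
have delta0 := delta_ge0 hyp.
move=> C0 unbounded; apply: contrapT => /forallNP short.
have {}short a : l a < 2 * ip a^-1%g a + C by rewrite ltNge; apply/negP/short.
pose n := (Num.truncn (4 * delta + 2 * C)).+1.
have nC : 4 * delta + 2 * C < n%:R := truncnS_gt _.
have [x xn] := unbounded (n + n)%N.
have [t [_ _ _ tlen]] := geodesic genS x.
have [|tn txn] := tlen n; first lia.
(* Both ends of a geodesic to [x], seen from its vertex [t n]: their Gromov product is 0 and both
   have length at least [n]. *)
pose g := ((t n)^-1)%g; pose h := ((t n)^-1 * x)%g.
have lg : l g = n%:R by rewrite word_lengthV tn.
have lh : n%:R <= l h by rewrite ler_nat txn; lia.
have gh0 : ip g h = 0.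
  rewrite gp1E invgK mulVKg lg txn natrB; last lia.
  lra.
have sg := short g; have sh := short h.
have g1h : ip g^-1%g h <= delta.
  case: (@gp1_hyp g g^-1%g h 0); rewrite ?gh0//; last by rewrite add0r.
  by rewrite (gp1C g); lra.
have gh1 : ip g h^-1%g <= delta.
  by case: (@gp1_hyp g h^-1%g h 0); rewrite ?gh0// ?add0r//; lra.
pose f := (g * h)%g.
have lf : l f = l g + l h - 2 * ip g^-1%g h := word_lengthME g h.
have gf : ip g f = l g - ip g^-1%g h := gp1_mul g h.
have hf : ip h^-1%g f^-1%g = l h - ip g^-1%g h.
  by rewrite /f (invgM g h) gp1_mul invgK (word_lengthV genS h) gp1C.
have gf1 : ip g f^-1%g <= delta + delta.
  by case: (gp1_hyp f^-1%g gh1) => //; rewrite (gp1C f^-1%g) hf; lra.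
have ff1 : ip f f^-1%g <= delta + delta + delta.
  by case: (gp1_hyp f gf1) => //; rewrite gf; lra.
(* The length of [f] is at least [2 * n - 2 * delta], while [short f] bounds it by [6 * delta + C];
   this contradicts [nC]. *)
by have := short f; rewrite (gp1C f^-1%g) lf; lra.
Qed.

Definition gpow a (b : bool) n : G := if b then (a ^+ n)%g else (a ^- n)%g.

(** Quantitative loxodromy: the powers of [a] trace a quasi-axis whose two rays from [1] separate
    within [c]. *)
Definition axial a (c : R) : Prop :=
  (forall n, n%:R <= l (a ^+ n)%g) /\ (forall m n, ip (a ^- m)%g (a ^+ n)%g <= c).

Lemma axialV a c : axial a c -> axial a^-1%g c.
Proof.
move=> [a1 a2]; split=> [n|m n]; first by rewrite expVgn word_lengthV.
by rewrite !expVgn invgK gp1C.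
Qed.

Lemma gp1_1l x : ip 1%g x = 0.
Proof.
by apply/eqP; rewrite eq_le gp1_ge0 andbT (le_trans (gp1_lel _ _))// word_length1.
Qed.

(** By [long_product], positive powers start along [a] and negative ones along [a^-1]; two uses of
    hyperbolicity then separate the rays. *)
Lemma axial_loxodromic a : 2 * ip a^-1%g a + (4 * delta + 1) <= l a ->
  axial a (ip a^-1%g a + 2 * delta).
Proof.
have delta0 := delta_ge0 hyp.
set K := ip a^-1%g a => la; have K0 : 0 <= K := gp1_ge0 _ _.
have powP f n : ip f^-1%g f <= K -> 2 * K + (4 * delta + 1) <= l f ->
    l f - K - delta <= ip f (f ^+ n.+1)%g /\ n.+1%:R <= l (f ^+ n.+1)%g.
  move=> fK lf; have prodE : (\prod_(x <- f :: nseq n f) x = f ^+ n.+1)%g.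
    rewrite expgS big_cons; congr (_ * _)%g.
    by elim: n => [|n IH]; rewrite ?big_nil// big_cons IH expgS.
  have := @long_product K f (nseq n f) K0; rewrite prodE /= size_nseq; apply.
    by elim: n {prodE} => //= n ->; rewrite fK.
  by rewrite all_nseq; apply/andP; split; [|apply/orP; right]; lra.
have Ka1 : ip (a^-1)^-1%g a^-1%g <= K by rewrite invgK gp1C.
split=> [[|n]|[|m] [|n]]; rewrite ?expg0 ?invg1 ?gp1_1l//; try by lra.
- by have [] := powP a n (lexx _) la.
- by rewrite gp1C gp1_1l; lra.
have [||am _] := powP a^-1%g m; rewrite ?word_lengthV//.
have [an _] := powP a n (lexx _) la.
rewrite expVgn word_lengthV in am.
have K1 : ip (a ^- m.+1)%g a <= K + delta.
  case: (@gp1_hyp a^-1%g (a ^- m.+1)%g a K) => //; lra.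
case: (gp1_hyp (a ^+ n.+1)%g K1); first lra.
rewrite (gp1C (a ^+ n.+1)%g a); lra.
Qed.

Lemma axial_gp a c j n : axial a c -> (j <= n)%N ->
  l (a ^+ j)%g - c <= ip (a ^+ j)%g (a ^+ n)%g.
Proof.
move=> ax jn; have -> : (a ^+ n = a ^+ j * a ^+ (n - j))%g by rewrite -expgnDr subnKC.
by rewrite gp1_mul; have [_ /(_ j (n - j)%N)] := ax; lra.
Qed.

Lemma axial_gp_min a c j n : axial a c ->
  Num.min (l (a ^+ j)%g) (l (a ^+ n)%g) - c <= ip (a ^+ j)%g (a ^+ n)%g.
Proof.
move=> ax; case/orP: (leq_total j n) => /(axial_gp ax); rewrite ?(gp1C (a ^+ n)%g).
  by apply: le_trans; rewrite lerD2r ge_min lexx.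
by apply: le_trans; rewrite lerD2r ge_min lexx orbT.
Qed.

Lemma word_length_exp a n : l (a ^+ n)%g <= n%:R * l a.
Proof.
elim: n => [|n IH]; first by rewrite word_length1 mul0r.
rewrite expgS; have : l (a * a ^+ n)%g <= l a + l (a ^+ n)%g.
  by rewrite -natrD ler_nat word_lengthM.
by rewrite -natr1 mulrDl mul1r; lra.
Qed.

Lemma in_cycleV a x : in_cycle a x -> in_cycle a x^-1%g.
Proof.
by move=> [n [->|->]]; exists n; [right|left]; rewrite ?invgK.
Qed.

Lemma in_cycleM a x y : in_cycle a x -> in_cycle a y -> in_cycle a (x * y)%g.
Proof.
have mulXV m n : in_cycle a (a ^+ m * a ^- n)%g.
  have [mn|/ltnW nm] := leqP m n; last by exists (m - n)%N; left; rewrite expgnFr.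
  by exists (n - m)%N; right; rewrite expgnFr// invgF.
have mulVX m n : in_cycle a (a ^- m * a ^+ n)%g.
  have := mulXV n m; have : commute (a ^+ n)%g (a ^- m)%g.
    by apply/commuteV/commuteX2.
  by move=> ->.
move=> [m [->|->]] [n [->|->]]; rewrite ?mulXV ?mulVX//.
  by exists (m + n)%N; left; rewrite expgnDr.
by exists (n + m)%N; right; rewrite expgnDr invgM.
Qed.

(** * Non-elementarity: independent directions and a free pair *)

Hypothesis nelG : ~ virtually_cyclic G.

Lemma word_length_unbounded n : exists x, (n <= len x)%N.
Proof.
apply: contrapT => /forallNP bounded; apply: nelG.
exists 1%g, [fset x | x in word_ball S n]%fset => g; exists g.
  apply/imfsetP; exists g => //=; apply: (mem_word_ball (genS := genS)).
  by have /negP := bounded g; lia.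
by exists 0%N; left; rewrite mulVg.
Qed.

(** Otherwise the ball of radius [n] would represent all cosets of the cyclic subgroup; [h] is a
    shortest element of a coset missing the ball. *)
Lemma exists_far_coset a n : exists2 h, (n < len h)%N &
  forall b m, (len h <= len (h * gpow a b m)%g)%N.
Proof.
have [g gfar] : exists g, forall f, (len f <= n)%N -> ~ in_cycle a (f^-1 * g)%g.
  apply: contrapT => /forallNP near; apply: nelG.
  exists a, [fset x | x in word_ball S n]%fset => g.
  have /existsNP[f /not_implyP[fn /contrapT fg]] := near g; exists f => //.
  by apply/imfsetP; exists f => //=; apply: (mem_word_ball (genS := genS)).
have ex : exists k, `[< exists2 c, in_cycle a c & len (g * c)%g = k >].
  exists (len g); apply/asboolP; exists 1%g; rewrite ?mulg1//.
  by exists 0%N; left.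
case: (ex_minnP ex) => k /asboolP[c ca ck] kmin; exists (g * c)%g.
  rewrite ltnNge; apply/negP => /gfar; apply.
  by rewrite invgM mulgVK; exact: in_cycleV.
move=> b m; rewrite ck; apply: kmin; apply/asboolP; exists (c * gpow a b m)%g.
  by apply: in_cycleM => //; exists m; case: b; [left|right].
by rewrite mulgA.
Qed.

(* If both ends of the translated axis [h <a>] were ends of [<a>], they would
   have to be the same end, because the axis [h <a>] is far from [1]. *)
Lemma exists_independent : exists a h c T, [/\ axial a c, 0 <= T &
  forall n b m, ip (h * a ^+ n)%g (gpow a b m) <= l h + T].
Proof.
have delta0 := delta_ge0 hyp.
have [|a la] := @exists_loxodromic (4 * delta + 1) _ word_length_unbounded.
  lra.
have := axial_loxodromic la; set c := (_ + _) => ax.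
have c0 : 0 <= c by have := gp1_ge0 a^-1%g a; rewrite /c; lra.
(* Ensures that half the length of [a ^+ J] exceeds [c + delta]. In [ip_h1], minimality of [h]
   bounds its overlap with [a ^+ J] by half that length, so higher powers, which follow [a ^+ J]
   longer, overlap no more than that plus [delta]. *)
pose J := (Num.truncn (2 * c + 2 * delta)).+1.
have JC : 2 * c + 2 * delta < J%:R := truncnS_gt _.
pose K := J%:R * l a + delta.
have [h hfar hmin] := exists_far_coset a (Num.truncn (K + c + 3 * delta)).+1.
have lh : K + c + 3 * delta < l h.
  by apply: (lt_trans (truncnS_gt _)); rewrite ltr_nat.
have ax_b (b : bool) : axial (if b then a else a^-1%g) c.
  by case: b => //; exact: axialV.
have gpowE b n : gpow a b n = ((if b then a else a^-1) ^+ n)%g.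
  by case: b; rewrite //= expVgn.
have ip_h1 b n : ip h^-1%g (gpow a b n) <= K.
  have half m : ip h^-1%g (gpow a b m) <= l (gpow a b m) / 2.
    have := hmin b m; rewrite -(ler_nat R) word_lengthME; lra.
  have leJ m : (m <= J)%N -> l (gpow a b m) <= J%:R * l a.
    move=> mJ; apply: (@le_trans _ _ (m%:R * l a)).
      rewrite gpowE (le_trans (word_length_exp _ _))//.
      by case: (b); rewrite ?word_lengthV.
    by rewrite ler_wpM2r// ler_nat.
  have la0 : 0 <= J%:R * l a by rewrite mulr_ge0.
  have [nJ|Jn] := leqP n J.
    by have := gp1_ler h^-1%g (gpow a b n); have := leJ n nJ; rewrite /K; lra.
  have halfJ := half J; have leJJ := leJ J (leqnn _).
  case: (gp1_hyp (gpow a b n) halfJ); first by rewrite /K; lra.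
  have [Jle _] := ax_b b; have := Jle J.
  have := axial_gp (ax_b b) (ltnW Jn).
  by rewrite (gp1C (gpow a b n)) !gpowE in halfJ leJJ *; lra.
have ip_hh b n : l h - K <= ip h (h * gpow a b n)%g.
  by rewrite gp1_mul; have := ip_h1 b n; lra.
pose T := 2 * c + 2 * delta + 1; have T0 : 0 <= T by rewrite /T; lra.
pose good b := forall n b' m,
  ip (h * (if b then a else a^-1) ^+ n)%g (gpow a b' m) <= l h + T.
suff [Hgood|Hgood] : good true \/ good false.
- by exists a, h, c, T.
- exists a^-1%g, h, c, T; split => // [|n b m]; first exact: axialV.
  suff -> : gpow a^-1%g b m = gpow a (~~ b) m by exact: Hgood.
  by case: b; rewrite /gpow expVgn ?invgK.
apply: contrapT => /not_orP[bad1 bad2].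
have {}bad b : ~ good b -> exists n b' m, l h + T < ip (h * gpow a b n)%g (gpow a b' m).
  move=> bad; apply: contrapT => /forallNP none; apply: bad => n b' m.
  by rewrite leNgt -gpowE; apply/negP => lt; apply: (none n); exists b', m.
have [n1 [b1 [m1 H1]]] := bad _ bad1; have [n2 [b2 [m2 H2]]] := bad _ bad2.
set x1 := gpow a b1 m1 in H1 *; set x2 := gpow a b2 m2 in H2 *.
set y1 := (h * _)%g in H1; set y2 := (h * _)%g in H2.
have K0 : 0 <= K by rewrite addr_ge0// mulr_ge0.
have xh x b n : l h + T < ip (h * gpow a b n)%g x -> l h - K - delta <= ip x h.
  move=> H; apply: (@gp1_min (h * gpow a b n)%g); last by rewrite gp1C ip_hh.
  by rewrite gp1C; lra.
(* Both powers follow [h] for longer than [c], hence lie on the same ray of the axis. *)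
have x12 : l h - K - delta - delta <= ip x1 x2.
  by apply: (@gp1_min h); [apply: xh H1 | rewrite gp1C; apply: xh H2].
have b12 : b1 = b2.
  apply/eqP; rewrite -[_ == _]negbK; apply/negP => nb; have [_ axc] := ax.
  suff : ip x1 x2 <= c by lra.
  by rewrite /x1 /x2; case: (b1) (b2) nb => [] [] //= _; rewrite 1?gp1C axc.
(* On one ray the shorter power is followed up to [c], and both are longer than [l h + T]. The
   translated rays [y1], [y2] separate by [l h + c], which the choice of [T] makes incompatible with
   following [x1] and [x2]. *)
have x12' : l h + T - c <= ip x1 x2.
  have := axial_gp_min m1 m2 (ax_b b1); rewrite -!gpowE {2 4}b12 -/x1 -/x2.
  have := gp1_ler y1 x1; have := gp1_ler y2 x2.
  by rewrite minEle; case: ifP => _; lra.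
have y12 : ip y1 y2 <= l h + c.
  apply: (le_trans (gp1_mull_le _ _ _)); rewrite lerD2l.
  by rewrite gp1C; case: ax => _; apply.
case: (gp1_hyp x1 y12); first by rewrite /T in H1; lra.
move=> x1y2; case: (gp1_hyp x2 x1y2); first by rewrite /T in x12'; lra.
by rewrite gp1C; move: H2; rewrite /T; lra.
Qed.

(** Only positive words matter, so [a ^+ n] and [h * a ^+ n] suffice for large [n]: their inverses
    point the same way up to [l h], away from both forward directions. *)
Lemma exists_free_pair : exists A B K, [/\ 0 <= K,
  forall f f', f \in [:: A; B] -> f' \in [:: A; B] -> ip f^-1%g f' <= K,
  ip A B <= K & forall f, f \in [:: A; B] -> 2 * K + 4 * delta + 1 <= l f].
Proof.
have delta0 := delta_ge0 hyp.
have [a [h [c [T [ax T0 indep]]]]] := exists_independent.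
have [axn axc] := ax; have c0 : 0 <= c by apply: le_trans (axc 0%N 0%N); exact: gp1_ge0.
pose K := 2 * l h + T + c.
pose n := (Num.truncn (2 * K + 4 * delta + 1 + l h)).+1.
have nK : 2 * K + 4 * delta + 1 + l h < n%:R := truncnS_gt _.
have lh0 : 0 <= l h by [].
have ha : ip (h * a ^+ n)%g (a ^+ n)%g <= l h + T := indep n true n.
have ha1 : ip (h * a ^+ n)%g (a ^- n)%g <= l h + T := indep n false n.
exists (a ^+ n)%g, (h * a ^+ n)%g, K; split.
- by rewrite /K; lra.
- move=> f f'; rewrite !inE => /orP[] /eqP-> /orP[] /eqP->.
  + by have := axc n n; rewrite /K; lra.
  + by rewrite gp1C /K; lra.
  + rewrite invgM; have := gp1_mulr_le (a ^- n)%g h^-1%g (a ^+ n)%g.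
    by have := axc n n; rewrite word_lengthV /K; lra.
  + rewrite invgM; have := gp1_mulr_le (a ^- n)%g h^-1%g (h * a ^+ n)%g.
    by rewrite (gp1C (a ^- n)%g (h * _)%g) word_lengthV /K; lra.
- by rewrite gp1C /K; lra.
- have lan := axn n.
  move=> f; rewrite !inE => /orP[] /eqP->; first lra.
  have : l (a ^+ n)%g <= l h^-1%g + l (h * a ^+ n)%g.
    by rewrite -natrD ler_nat -[X in (len X <= _)%N](mulKg h) word_lengthM.
  by rewrite word_lengthV; lra.
Qed.

End FreeSemigroup.

(** * Words of a given length in two elements *)

Section Words.
Variables (G : groupType) (A B : G).

Fixpoint words n : seq G :=
  if n is n'.+1 then
    [seq (A * w)%g | w <- words n'] ++ [seq (B * w)%g | w <- words n']
  else [:: 1%g].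

Lemma size_words n : size (words n) = (2 ^ n)%N.
Proof. by elim: n => //= n IH; rewrite size_cat !size_map IH expnS; lia. Qed.

Lemma words_prod n w : w \in words n ->
  exists2 s : seq G, all (mem [:: A; B]) s & w = (\prod_(x <- s) x)%g.
Proof.
elim: n w => [|n IH] w /=.
  by rewrite inE => /eqP->; exists [::]; rewrite ?big_nil.
rewrite mem_cat => /orP[] /mapP[v /IH[s sAB ->] ->].
  by exists (A :: s); rewrite ?big_cons //= inE eqxx.
by exists (B :: s); rewrite ?big_cons //= !inE eqxx orbT.
Qed.

(** [words] grows on the left, whereas successive averages are compared along edges added on the
    right. *)
Lemma sum_wordsS (V : nmodType) (F : G -> V) n :
  \sum_(w <- words n.+1) F w = \sum_(w <- words n) (F (w * A)%g + F (w * B)%g).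
Proof.
elim: n F => [|n IH] F.
  by rewrite /= big_cons !big_seq1 !mulg1 !mul1g.
have wordsS m : words m.+1 =
  [seq (A * w)%g | w <- words m] ++ [seq (B * w)%g | w <- words m] by [].
rewrite (wordsS n.+1) (wordsS n) !big_cat !big_map -/(words n.+1) !IH.
by congr (_ + _); apply: eq_bigr => w _; rewrite !mulgA.
Qed.

End Words.

(** * A free semigroup avoiding any given direction *)

Section Tree.
Variables (R : realType) (G : groupType) (S : {fset G}).
Hypothesis genS : generates S.
Local Notation len := (word_length genS).
Local Notation l x := ((len x)%:R : R).
Local Notation ip x y := (gromov_product genS R 1%g x y).
Variable delta : R.
Hypothesis hyp : forall o x y z,
  Num.min (gromov_product genS R o x y) (gromov_product genS R o y z) - delta
    <= gromov_product genS R o x z.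
Hypothesis nelG : ~ virtually_cyclic G.

(** Words with different first letters separate within [K + 2 * delta] for the [K] of the free pair,
    and are longer than that, hence distinct. So [g] cannot follow words of both kinds beyond
    [K + 3 * delta]. *)
Lemma exists_free_semigroup : exists (A B : G) (K : R),
  (forall n, uniq (words A B n)) /\
  forall g, exists2 t, t \in [:: A; B] &
    forall n w, w \in words A B n -> ip (t * w)%g g <= K.
Proof.
have delta0 := delta_ge0 hyp.
have [A [B [K [K0 ipK ipAB lK]]]] := exists_free_pair hyp nelG.
have first_letter f n w : f \in [:: A; B] -> w \in words A B n ->
    l f - K - delta <= ip f (f * w)%g.
  move=> fAB /words_prod[s sAB ->].
  have -> : (f * \prod_(x <- s) x = \prod_(x <- f :: s) x)%g by rewrite big_cons.
  have fsAB : all (mem [:: A; B]) (f :: s) by rewrite /= fAB.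
  have [||] // := long_product hyp (f := f) (s := s) K0.
    elim: s f fAB {sAB} fsAB => //= g s IH f fAB /andP[_ gsAB].
    by have /andP[gAB _] := gsAB; rewrite ipK// IH.
  by apply: sub_all fsAB => x /lK; lra.
have AAB : A \in [:: A; B] by exact: mem_head.
have BAB : B \in [:: A; B] by rewrite !inE eqxx orbT.
have lA := lK A AAB; have lB := lK B BAB.
have sep m n w w' : w \in words A B m -> w' \in words A B n ->
    ip (A * w)%g (B * w')%g <= K + delta + delta.
  move=> /(first_letter _ _ _ AAB) fA /(first_letter _ _ _ BAB) fB.
  case: (gp1_hyp hyp (A * w)%g ipAB); first lra.
  rewrite gp1C => BA; have := BA; rewrite gp1C => AB.
  case: (gp1_hyp hyp (B * w')%g AB) => //; rewrite gp1C; lra.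
exists A, B, (K + delta + delta + delta); split.
  elim=> //= n IH; rewrite cat_uniq !map_inj_uniq ?IH ?andbT /=; try exact: mulgI.
  apply/hasPn => _ /mapP[w' wn' ->]; apply/mapP => -[w wn E].
  have := sep _ _ _ _ wn wn'; rewrite E gp1xx.
  have := first_letter A _ _ AAB wn.
  have := gp1_ler R genS A (A * w)%g; lra.
move=> g.
have [?|/existsNP[n /existsNP[w /not_implyP[wn bad]]]] :=
  pselect (forall n w, w \in words A B n ->
    ip (A * w)%g g <= K + delta + delta + delta).
  by exists A.
exists B => //.
move=> m w' wm; have := sep _ _ _ _ wn wm.
move=> /(gp1_hyp hyp g)[//|]; by rewrite gp1C.
Qed.

End Tree.

(** * Elementary estimates for [p]-th powers *)

Section PowerEstimates.
Variables (R : realType) (p : R).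
Hypothesis p1 : 1 <= p.

Let p0 : 0 < p. Proof. exact: lt_le_trans p1. Qed.

(* A cheap substitute for Jensen's inequality when summing many [a]'s. *)
Lemma ler_split_powR (a r : R) : 0 <= a -> 0 < r ->
  a <= r + a `^ p / r `^ (p - 1).
Proof.
move=> a0 r0; have rp : 0 < r `^ (p - 1) by rewrite powR_gt0.
have [ar|ra] := leP a r.
  by rewrite (le_trans ar)// lerDl divr_ge0 ?powR_ge0.
rewrite -[leLHS]add0r lerD ?(ltW r0)// ler_pdivlMr// -(mulr_powRB1 a0 p0).
rewrite ler_wpM2l// ge0_ler_powR ?nnegrE ?(ltW ra) ?(ltW r0) ?subr_ge0//.
Qed.

Lemma powRD_le (a b : R) : 0 <= a -> 0 <= b ->
  (a + b) `^ p <= 2 `^ p * (a `^ p + b `^ p).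
Proof.
move=> a0 b0; wlog ab : a b a0 b0 / a <= b.
  by move=> H; case/orP: (le_total a b) => /H; [|rewrite addrC (addrC (b `^ p))]; apply.
apply: (@le_trans _ _ ((2 * b) `^ p)).
  by rewrite ge0_ler_powR ?nnegrE ?(ltW p0)// ?addr_ge0 ?mulr_ge0//
    mulr2n mulrDl mul1r lerD2r.
by rewrite powRM// ler_wpM2l ?powR_ge0// lerDr powR_ge0.
Qed.

(** The threshold [r] is free: constant along a geodesic, geometrically decaying along the levels of
    the tree. *)
Lemma sum_norm_le (T : Type) (X : seq T) (F : T -> R) (r : R) : 0 < r ->
  \sum_(x <- X) `|F x| <=
    (size X)%:R * r + (\sum_(x <- X) `|F x| `^ p) / r `^ (p - 1).
Proof.
move=> r0; apply: (@le_trans _ _ (\sum_(x <- X) (r + `|F x| `^ p / r `^ (p - 1)))).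
  by apply: ler_sum => x _; exact: ler_split_powR.
by rewrite big_split /= big_const_seq count_predT iter_addr addr0 mulr_natl -mulr_suml.
Qed.

End PowerEstimates.

(** * What finite energy controls: translations and averages over words *)

Section Energy.
Variables (R : realType) (G : groupType) (S : {fset G}) (p : R).
Hypothesis p1 : 1 <= p.
Implicit Types (u f : G -> R) (M : R).

Let p0 : 0 < p. Proof. exact: lt_le_trans p1. Qed.

Lemma le_wsum_seq (T : choiceType) (D : set T) (c M : R) (f : T -> R) (X : seq T) :
  0 <= c -> (wsum D c p f <= M%:E)%E -> uniq X -> (forall x, x \in X -> D x) ->
  c * (\sum_(x <- X) `|f x| `^ p) <= M.
Proof.
move=> c0 fM uX XD.
have XE : perm_eq X [fset x in X]%fset.
  by apply: uniq_perm => // x; rewrite in_fset.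
rewrite (perm_big _ XE) /=.
by apply: (le_wsum c0 fM) => x; rewrite in_fset => /XD.
Qed.

Lemma Ep_energyN u : Ep_energy S p (- u) = Ep_energy S p u.
Proof.
rewrite /Ep_energy; congr (_ * _)%E; apply: eq_esum => e _.
by rewrite !fctE -opprD normrN.
Qed.

Lemma lp_energyN u : lp_energy p (- u) = lp_energy p u.
Proof. by apply: eq_esum => e _; rewrite !fctE normrN. Qed.

Hypothesis genS : generates S.

(** Right translation by [t] follows a word spelling [t]. For a fixed letter the arcs [(y, y * s)]
    are distinct, so each step costs at most [2 * M]. *)
Lemma sum_translate_le t : exists2 C : R, 0 <= C & forall u M,
  (Ep_energy S p u <= M%:E)%E -> forall Y : seq G, uniq Y ->
  \sum_(y <- Y) `|u y - u (y * t)%g| `^ p <= C * M.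
Proof.
have [w [wS <-]] := genS t; elim: w wS => [|s w IH] /=.
  move=> _; exists 0 => // u M uM Y uY; rewrite mul0r big_nil.
  by rewrite big1// => y _; rewrite mulg1 subrr normr0 powR0 ?gt_eqF.
move=> /andP[sS wS]; have [C C0 HC] := IH wS; rewrite big_cons.
set t' := (\prod_(x <- w) x)%g in HC *.
exists (2 `^ p * (2 + C)); first by rewrite mulr_ge0 ?powR_ge0// addr_ge0.
move=> u M uM Y uY.
have M0 : 0 <= M.
  by rewrite -lee_fin; apply: le_trans uM; apply: wsum_ge0; rewrite invr_ge0.
have shift : \sum_(y <- Y) `|u (y * s)%g - u (y * s * t')%g| `^ p <= C * M.
  rewrite -(big_map (fun y => y * s)%g xpredT
    (fun y => `|u y - u (y * t')%g| `^ p)); apply: HC => //.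
  by rewrite map_inj_uniq//; exact: mulIg.
have step : \sum_(y <- Y) `|u y - u (y * s)%g| `^ p <= 2 * M.
  (* A letter may be trivial, and loops are not arcs. *)
  have [->|s1] := eqVneq s 1%g.
    rewrite big1 ?mulr_ge0// => y _.
    by rewrite mulg1 subrr normr0 powR0 ?gt_eqF.
  rewrite -ler_pdivrMl// -(big_map (fun y => (y, y * s)%g) xpredT
    (fun e => `|u e.1 - u e.2| `^ p)).
  apply: (le_wsum_seq (f := fun e => u e.1 - u e.2) _ uM); first by rewrite invr_ge0.
    by rewrite map_inj_uniq// => y z [].
  move=> _ /mapP[y _ ->]; split=> /=; last by rewrite mulKg.
  by apply: contra_neq s1 => ys; apply: (@mulgI _ y); rewrite mulg1.
rewrite -mulrA mulrDl; apply: (@le_trans _ _ (2 `^ p *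
    (\sum_(y <- Y) `|u y - u (y * s)%g| `^ p +
     \sum_(y <- Y) `|u (y * s)%g - u (y * s * t')%g| `^ p))); last first.
  by rewrite ler_wpM2l ?powR_ge0// lerD.
rewrite -big_split /= mulr_sumr; apply: ler_sum => y _.
apply: le_trans (powRD_le p1 (normr_ge0 _) (normr_ge0 _)).
rewrite ge0_ler_powR ?nnegrE ?(ltW p0) ?addr_ge0//.
by rewrite mulgA -[u y - _](subrKA (u (y * s)%g)) ler_normD.
Qed.

Lemma translate_diff_le t M : 0 <= M -> exists2 C : R, 0 <= C &
  forall u, (Ep_energy S p u <= M%:E)%E -> forall y, `|u y - u (y * t)%g| <= C.
Proof.
move=> M0; have [C C0 HC] := sum_translate_le t; exists (1 + C * M).
  by rewrite addr_ge0// mulr_ge0.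
move=> u uM y; have := HC u M uM [:: y] isT; rewrite big_seq1 => le.
apply: (le_trans (ler_split_powR p1 (normr_ge0 _) ltr01)).
by rewrite powR1 divr1 lerD2l.
Qed.

(** Going from level [n] to [n + 1] changes the average by a mean of [2 ^+ n] pairs of differences.
    As the words are distinct, the [p]-th powers of these have a sum bounded independently of [n],
    so the changes are summable. *)
Lemma words_average_le A B M : (forall n, uniq (words A B n)) -> 0 <= M ->
  exists2 C : R, 0 <= C & forall u, (Ep_energy S p u <= M%:E)%E ->
  forall x n, `|u x - (\sum_(w <- words A B n) u (x * w)%g) / 2 ^+ n| <= C.
Proof.
move=> uW M0; have [CA CA0 HA] := sum_translate_le A.
have [CB CB0 HB] := sum_translate_le B.
(* With threshold [a ^+ n] and [a ^ (p - 1) >= 3 / 4], the power term grows at most like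
   [(4 / 3) ^+ n]; dividing by the number of words leaves [(2 / 3) ^+ n]. *)
pose a : R := (3 / 4) `^ p^-1.
have a01 : 0 < a < 1.
  rewrite powR_gt0//=; have := @gt0_ltr_powR R p^-1; rewrite invr_gt0 => /(_ p0).
  by move=> /(_ (3 / 4) 1); rewrite powR1; apply; rewrite ?nnegrE//; lra.
have ap : 3 / 4 <= a `^ (p - 1).
  rewrite /a -powRrM ger1_powR//; first by apply/andP; split; lra.
  by rewrite ler_pdivrMl//; lra.
pose E := (CA + CB) * M; have E0 : 0 <= E by rewrite mulr_ge0// addr_ge0.
pose e (k : nat) : R := a ^+ k + E * (2 / 3) ^+ k.
exists ((1 - a)^-1 + E * (1 - 2 / 3)^-1).
  case/andP: a01 => _ a1.
  apply: addr_ge0; first by rewrite invr_ge0; lra.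
  by apply: mulr_ge0 => //; rewrite invr_ge0; lra.
move=> u uM x n; apply: (@le_trans _ _ (\sum_(k < n) e k)); last first.
  rewrite big_split /= -mulr_sumr lerD//; first apply: ler_sum_geometric.
    by case/andP: a01 => /ltW -> ->.
  by rewrite ler_wpM2l// ler_sum_geometric//; apply/andP; split; lra.
elim: n => [|n IH].
  by rewrite big_ord0 /= big_seq1 mulg1 expr0 divr1 subrr normr0.
rewrite big_ord_recr /=; set s := \sum_(w <- words A B n) u (x * w)%g in IH.
have P2 : 0 < 2 ^+ n :> R by rewrite exprn_gt0.
rewrite -[_ - _](subrKA (s / 2 ^+ n)); apply: le_trans (ler_normD _ _) _.
rewrite lerD//; apply: (@le_trans _ _ ((\sum_(w <- words A B n)
    (`|u (x * w)%g - u (x * w * A)%g| + `|u (x * w)%g - u (x * w * B)%g|)) / 2 ^+ n.+1)).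
  rewrite sum_wordsS.
  have -> : s / 2 ^+ n =
      (\sum_(w <- words A B n) (u (x * w)%g + u (x * w)%g)) / 2 ^+ n.+1.
    by rewrite big_split /= -/s exprS; field; rewrite gt_eqF.
  rewrite -mulrBl normrM [X in _ * X]ger0_norm ?invr_ge0 ?exprn_ge0//.
  rewrite ler_pM2r ?invr_gt0 ?exprn_gt0// -sumrB.
  apply: le_trans (ler_norm_sum _ _ _) _; apply: ler_sum => w _.
  by rewrite !mulgA opprD addrACA ler_normD.
have bound t C : (forall u M, (Ep_energy S p u <= M%:E)%E -> forall Y : seq G, uniq Y ->
      \sum_(y <- Y) `|u y - u (y * t)%g| `^ p <= C * M) ->
    \sum_(w <- words A B n) `|u (x * w)%g - u (x * w * t)%g| <=
      2 ^+ n * a ^+ n + C * M / (3 / 4) ^+ n.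
  move=> HC; have a0 : 0 < a ^+ n by rewrite exprn_gt0//; case/andP: a01.
  rewrite -(big_map (fun w => x * w)%g xpredT (fun y => `|u y - u (y * t)%g|)).
  apply: (le_trans (sum_norm_le p1 _ _ a0)); rewrite size_map size_words natrX lerD2l.
  have := HC u M uM [seq (x * w)%g | w <- words A B n].
  rewrite map_inj_uniq; last exact: mulgI.
  move=> /(_ (uW n)) le; apply: ler_pM => //.
  - by rewrite sumr_ge0// => y _; rewrite powR_ge0.
  - by rewrite invr_ge0 powR_ge0.
  - have q0 : 0 < (3 / 4) ^+ n :> R by rewrite exprn_gt0//; lra.
    rewrite lef_pV2 ?posrE ?powR_gt0//.
    rewrite -powR_mulrn; last by case/andP: a01 => /ltW.
    rewrite powRAC powR_mulrn ?powR_ge0//.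
    by rewrite lerXn2r ?nnegrE ?powR_ge0//; lra.
rewrite big_split /=; have := bound A CA HA; have := bound B CB HB => leB leA.
rewrite ler_pdivrMr ?exprn_gt0//; apply: (le_trans (lerD leA leB)).
have X0 : 0 <= E * (2 / 3) ^+ n * 2 ^+ n.
  by rewrite !mulr_ge0 ?exprn_ge0//; lra.
have XE : E * (2 / 3) ^+ n * 2 ^+ n = CA * M / (3 / 4) ^+ n + CB * M / (3 / 4) ^+ n.
  rewrite -mulrDl -mulrDl -/E -exprVn -mulrA -exprMn; congr (_ * _ ^+ _).
  by field.
have -> : e n * 2 ^+ n.+1 = 2 * (2 ^+ n * a ^+ n) + 2 * (E * (2 / 3) ^+ n * 2 ^+ n).
  by rewrite /e exprS; move: (2 ^+ n) ((2 / 3) ^+ n) (a ^+ n) => r s0 t; ring.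
move: X0 XE; move: (E * _ * _) (CA * M / _) (CB * M / _) (2 ^+ n * a ^+ n).
by move=> X c c' t X0 XE; lra.
Qed.

(** Threshold 1 and any [n] with [2 ^+ n] at least the energy of [f]. That [n] depends on [f] is
    harmless, since [words_average_le] is uniform in [n]. *)
Lemma words_lp_average_le A B f : (forall n, uniq (words A B n)) ->
  (lp_energy p f < +oo)%E ->
  forall x, exists n, (\sum_(w <- words A B n) `|f (x * w)%g|) / 2 ^+ n <= 2.
Proof.
move=> uW foo x; have f0 : (0 <= lp_energy p f)%E.
  by apply: esum_ge0 => y _; rewrite lee_fin powR_ge0.
pose F := fine (lp_energy p f); have FE : lp_energy p f = F%:E.
  by rewrite fineK// ge0_fin_numE.
pose n := (Num.truncn F).+1; exists n.
have Fn : F <= 2 ^+ n.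
  apply: le_trans (ltW (truncnS_gt _)) _; rewrite -natrX ler_nat.
  exact/ltnW/ltn_expl.
have P2 : 0 < 2 ^+ n :> R by rewrite exprn_gt0.
rewrite ler_pdivrMr// -(big_map (fun w => x * w)%g xpredT (fun y => `|f y|)).
apply: (le_trans (sum_norm_le p1 _ _ ltr01)).
rewrite size_map size_words natrX mulr1 powR1 divr1 mulr2n mulrDl mul1r lerD2l.
apply: le_trans Fn; rewrite -[leLHS]mul1r.
apply: (@le_wsum_seq _ setT) => //; first by rewrite /wsum mul1e -/(lp_energy p f) FE.
by rewrite map_inj_uniq//; exact: mulgI.
Qed.

End Energy.

(** * The kernel cocycle: properness and finite energy *)

Section Proper.
Variables (R : realType) (G : groupType).
Variables (S0 : {fset G}) (gen0 : generates S0) (S : {fset G}) (genS : generates S).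
Variable p : R.
Hypothesis p1 : 1 <= p.
Local Notation len := (word_length gen0).
Local Notation l x := ((len x)%:R : R).
Implicit Types (u v f h : G -> R) (M : R).

(** The vertices of a geodesic are distinct, so the [p]-th powers of the increments have bounded sum
    and the slope [r] is arbitrary. The geodesic is for [S0], the energy for [S]; [sum_translate_le]
    bridges the two. *)
Lemma geodesic_diff_le (r M : R) : 0 < r -> 0 <= M ->
  exists2 C : R, 0 <= C & forall u, (Ep_energy S p u <= M%:E)%E ->
  forall g, `|u 1%g - u g| <= r * l g + C.
Proof.
move=> r0 M0.
have /choice[C HC] : forall t, exists C : R, 0 <= C /\ forall u M,
    (Ep_energy S p u <= M%:E)%E -> forall Y : seq G, uniq Y ->
    \sum_(y <- Y) `|u y - u (y * t)%g| `^ p <= C * M.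
  by move=> t; have [C ? ?] := sum_translate_le p1 genS t; exists C.
have rp : 0 < r `^ (p - 1) by rewrite powR_gt0.
have C0 : 0 <= \sum_(s <- letters S0) C s * M.
  by apply: sumr_ge0 => s _; rewrite mulr_ge0//; have [] := HC s.
exists ((\sum_(s <- letters S0) C s * M) / r `^ (p - 1)).
  by rewrite divr_ge0// ltW.
move=> u uM g; have [x [x0 xg xl xlen]] := geodesic gen0 g.
have -> : u 1%g - u g = \sum_(i <- iota 0 (len g)) (u (x i) - u (x i.+1)).
  rewrite -{1}x0 -{1}xg -[X in iota _ X]subn0 -/(index_iota _ _).
  rewrite (eq_bigr (fun i => - (u (x i.+1) - u (x i)))); last first.
    by move=> i _; rewrite opprB.
  by rewrite sumrN telescope_sumr// opprB.
apply: (le_trans (ler_norm_sum _ _ _)).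
apply: (le_trans (sum_norm_le p1 _ _ r0)).
rewrite size_iota mulrC lerD2l ler_pM2r ?invr_gt0//.
apply: (@le_trans _ _ (\sum_(i <- iota 0 (len g)) \sum_(s <- letters S0)
    `|u (x i) - u (x i * s)%g| `^ p)).
  rewrite !big_seq; apply: ler_sum => i; rewrite mem_iota /= add0n => il.
  have := xl i il; rewrite -mem_letters => sl.
  rewrite (big_fsetD1 _ sl) /= mulVKg lerDl sumr_ge0//.
rewrite exchange_big /=; apply: ler_sum => s _.
rewrite -(big_map x xpredT (fun y => `|u y - u (y * s)%g| `^ p)).
have [_ /(_ u M uM)] := HC s; apply.
rewrite map_inj_in_uniq ?iota_uniq// => i j.
rewrite !mem_iota /= !add0n => il jl xij.
by have [<- _] := xlen i (ltnW il); have [<- _] := xlen j (ltnW jl); rewrite xij.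
Qed.

(** Averaging over the branch at [x * t] reduces the [l^p] part to at most 2, so a lower bound of
    [h] on the branch passes to [v x] with a loss independent of [f], [k] and [x]. *)
Lemma tree_lower_bound A B M : (forall n, uniq (words A B n)) -> 0 <= M ->
  exists2 C : R, 0 <= C & forall v h f k, v = h + f + cst k ->
    (Ep_energy S p v <= M%:E)%E -> (lp_energy p f < +oo)%E ->
  forall x t c, t \in [:: A; B] ->
    (forall n w, w \in words A B n -> c <= h (x * (t * w))%g) ->
  c + k - C <= v x.
Proof.
move=> uW M0; have [C C0 HC] := words_average_le p1 genS uW M0.
have [DA DA0 HA] := translate_diff_le p1 genS A M0.
have [DB DB0 HB] := translate_diff_le p1 genS B M0.
exists (C + 2 + DA + DB); first by rewrite !addr_ge0.
move=> v h f k vE vM foo x t c tAB hc.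
have [n fn] := words_lp_average_le p1 uW foo (x * t)%g.
have vt : `|v x - v (x * t)%g| <= DA + DB.
  move: tAB; rewrite !inE => /orP[] /eqP->.
    by apply: le_trans (HA v vM x) _; rewrite lerDl.
  by apply: le_trans (HB v vM x) _; rewrite lerDr.
have P2 : 0 < 2 ^+ n :> R by rewrite exprn_gt0.
have := HC v vM (x * t)%g n; set a := (\sum_(w <- _) _) / _ => va.
suff : c + k - 2 <= a.
  move: va vt; rewrite !ler_norml => /andP[? ?] /andP[? ?]; lra.
apply: (@le_trans _ _ (c + k - (\sum_(w <- words A B n) `|f (x * t * w)%g|) / 2 ^+ n)).
  by rewrite lerD2l lerN2.
rewrite /a ler_pdivlMr// mulrBl divfK ?gt_eqF//.
have -> : (c + k) * 2 ^+ n = \sum_(w <- words A B n) (c + k).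
  by rewrite big_const_seq count_predT iter_addr addr0 size_words -[RHS]mulr_natr natrX.
rewrite -sumrB !big_seq; apply: ler_sum => w wn.
have := hc n w wn; rewrite mulgA vE !fctE => hw.
have := ler_norm (- f (x * t * w)%g); rewrite normrN; lra.
Qed.

Variable delta : R.
Hypothesis hyp : forall o x y z,
  Num.min (gromov_product gen0 R o x y) (gromov_product gen0 R o y z) - delta
    <= gromov_product gen0 R o x z.
Hypothesis nelG : ~ virtually_cyclic G.
Local Notation N := (smooth_dist gen0 delta).
Local Notation eps := (visual_rate delta).

Definition dist_cocycle g : G -> R := fun x => N g x - N 1%g x.

Lemma dist_cocycleM (g h x : G) :
  dist_cocycle (g * h)%g x = dist_cocycle h (g^-1 * x)%g + dist_cocycle g x.
Proof.
rewrite /dist_cocycle -(smooth_distM hyp g h (g^-1 * x)%g)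
  -(smooth_distM hyp g 1%g (g^-1 * x)%g).
by rewrite mulVKg mulg1; ring.
Qed.

Lemma dist_cocycle_proper M : 0 <= M -> exists n, forall g v f k,
  v = dist_cocycle g + f + cst k -> (Ep_energy S p v <= M%:E)%E ->
  (lp_energy p f < +oo)%E -> (len g <= n)%N.
Proof.
move=> M0; have [A [B [K [uW avoid]]]] := exists_free_semigroup hyp nelG.
have [C1 C10 H1] := tree_lower_bound uW M0.
(* A slope below 1/2: the two kernel values give [v 1 - v g >= l g / 2] up to constants, leaving
   [l g / 4] bounded. *)
have [|C2 C20 H2] := @geodesic_diff_le 4^-1 M _ M0; first by rewrite invr_gt0.
have [C3 C30 H3] := smooth_dist_add hyp K.
exists (Num.truncn (4 * (2 * C1 + C2 + 2 * C3))) => g v f k vE vM foo.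
rewrite truncn_ge_nat; last by rewrite mulr_ge0// !addr_ge0// mulr_ge0.
have [t tAB ht] := avoid g; have [t' tAB' ht'] := avoid g^-1%g.
have v1 : N g 1%g - C3 + k - C1 <= v 1%g.
  apply: (H1 _ _ _ _ vE vM foo _ t) => // n w wn; rewrite mul1g /dist_cocycle.
  have := H3 1%g g (t * w)%g; rewrite gromov_productC => /(_ (ht n w wn)); lra.
(* The same argument at [g] for [- v], with a branch avoiding [g^-1]; [k] changes sign and cancels
   in the sum. *)
have vg : N 1%g g - C3 - k - C1 <= - v g.
  have vE' : - v = - dist_cocycle g + - f + cst (- k).
    by rewrite vE; apply/funext => x; rewrite !fctE; ring.
  apply: (H1 (- v) (- dist_cocycle g) (- f) (- k) vE' _ _ _ t') => //.
  - by rewrite Ep_energyN.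
  - by rewrite lp_energyN.
  move=> n w wn; rewrite !fctE /dist_cocycle.
  have := H3 g 1%g (g * (t' * w))%g.
  rewrite -(gromov_productM R gen0 g^-1%g) mulVg mulg1 mulKg gromov_productC.
  by move=> /(_ (ht' n w wn)); lra.
have := smooth_dist_ge hyp g 1%g; have := smooth_dist_ge hyp 1%g g.
rewrite [word_dist _ g _]word_distC word_dist1 => N1 N2.
have := H2 v vM g; rewrite ler_norml => /andP[_]; lra.
Qed.

Lemma dist_cocycle_energy g :
  8 * #|` letters S0|%:R / eps <= p -> (Ep_energy S p (dist_cocycle g) < +oo)%E.
Proof.
move=> pbig; have e0 := visual_rate_gt0 hyp; have p0 : 0 < p := lt_le_trans ltr01 p1.
(* Bounds the [S0]-distance between the ends of an arc for [S]. *)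
pose L := (\sum_(s <- letters S) len s)%N.
have [C C0 HC] := smooth_dist_holder hyp (l g) L%:R.
pose V := #|` letters S0|; pose m := size (letters S).
pose r := expR (- (eps / 4 * p)).
(* At most [V ^ j * m] arcs start at length [j], each contributing at most [C ^ p * r ^+ j]. The
   assumption on [p] gives [eps / 4 * p >= 2 * V], so the ratio [V * r] is at most 1/2. *)
have Vr : 0 <= V%:R * r <= 2^-1.
  rewrite mulr_ge0 ?expR_ge0//= /r expRN ler_pdivrMr ?expR_gt0//.
  have := expR_ge1Dx (eps / 4 * p).
  have : 8 * V%:R <= p * eps by rewrite -ler_pdivrMr.
  lra.
pose D := C `^ p * (m%:R * (1 - V%:R * r)^-1).
have D0 : 0 <= D.
  by rewrite !mulr_ge0 ?powR_ge0// invr_ge0; lra.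
apply: (@le_lt_trans _ _ (2^-1 * D)%:E); last exact: ltry.
apply: (@wsum_le R _ (arcs S) 2^-1 p _
  (fun e => dist_cocycle g e.1 - dist_cocycle g e.2)).
- by rewrite invr_ge0.
- by rewrite mulr_ge0// invr_ge0.
move=> X XD; rewrite ler_pM2l ?invr_gt0//.
pose F (j : nat) := C `^ p * r ^+ j.
apply: (@le_trans _ _ (\sum_(e <- X) F (len e.1))).
  rewrite !big_seq; apply: ler_sum => -[x y] /XD[/= _ xy].
  have xyL : (word_dist gen0 x y)%:R <= L%:R :> R.
    rewrite ler_nat /L; move: xy; rewrite -mem_letters => xy.
    by rewrite (big_fsetD1 _ xy) /= leq_addr.
  have := HC 1%g g x y; rewrite word_dist1 lexx => /(_ isT xyL).
  rewrite word_dist1 distrC => le.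
  apply: (@le_trans _ _ ((C * expR (- (eps / 4 * l x))) `^ p)).
    rewrite ge0_ler_powR ?nnegrE ?(ltW p0) ?mulr_ge0 ?expR_ge0//.
    apply: le_trans le; rewrite le_eqVlt; apply/orP; left; apply/eqP.
    by congr `|_|; rewrite /dist_cocycle; ring.
  rewrite powRM ?expR_ge0// /F ler_wpM2l ?powR_ge0// /r -expR_natM.
  by rewrite /powR gt_eqF ?expR_gt0// expRK ler_expR; lra.
have [j|j|J] := @ler_sum_levels R _ X (fun e => len e.1) F (fun j => (V ^ j * m)%:R).
- by rewrite /F mulr_ge0 ?powR_ge0// exprn_ge0// expR_ge0.
- rewrite ler_nat -size_filter -(size_word_sphere S0 j) /m
    -(size_allpairs (fun x s => (x, x * s)%g)).
  apply: uniq_leq_size; first by rewrite filter_uniq.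
  move=> [x y]; rewrite mem_filter /= => /andP[/eqP <- /XD[/= _ xy]].
  apply/allpairsP; exists (x, x^-1 * y)%g; rewrite /= mulVKg; split => //.
    exact: mem_word_sphere.
  by rewrite mem_letters.
move=> /le_trans; apply.
rewrite (eq_bigr (fun j : 'I_J => C `^ p * m%:R * (V%:R * r) ^+ j)); last first.
  by move=> j _; rewrite /F natrM natrX exprMn; ring.
rewrite -mulr_sumr /D mulrA ler_wpM2l ?mulr_ge0 ?powR_ge0//.
by apply: ler_sum_geometric; lra.
Qed.

End Proper.

(** * From the kernel to cohomology classes *)

Theorem theorem1p3 (R : realType) (G : groupType)
    (hypG : hyperbolic_group R G) (nelG : ~ virtually_cyclic G) :
  exists2 p0 : R, 1 <= p0 &
    forall (p : R) (p1 : 1 <= p), p0 <= p ->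
    forall S : {fset G}, generates S ->
    exists c : G -> H1 S p1,
      is_cocycle (H1_action S p1) c /\ is_proper (H1_norm S p1) c.
Proof.
case: hypG => S0 [gen0 [delta hyp]].
exists (Num.max 1 (8 * #|` letters S0|%:R / visual_rate delta)).
  by rewrite le_max lexx.
move=> p p1; rewrite ge_max => /andP[_ pbig] S genS.
have memE g : dist_cocycle gen0 delta g \in Ep_pred S p1.
  by rewrite inE /=; exact: (dist_cocycle_energy S p1 hyp).
exists (fun g => lmod_pi (lp_const S p1) (MkEp (memE g))); split.
  move=> g h; rewrite /H1_action /= (quot_act_pi (@lp_const_translate _ _ S p p1)).
  apply: etrans (lmod_piD _ _ _); congr lmod_pi.
  by apply/val_inj/funext => x /=; rewrite (dist_cocycleM hyp).
move=> M.
have [n Hn] := dist_cocycle_proper genS p1 hyp nelG (powR_ge0 (`|M| + 1) p).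
apply: (@sub_finite_set _ _ [set` [fset x | x in word_ball S0 n]%fset]); last first.
  exact: finite_fset.
move=> g /= cM; apply/imfsetP; exists g => //=; apply: (mem_word_ball (genS := gen0)).
(* The quotient norm is an infimum, perhaps not attained; this slack yields a representative of norm
   at most [|M| + 1]. *)
have e1 : 0 < `|M| + 1 - M by have := ler_norm M; lra.
have [_ [v /= vE <-] vM] := inf_adherent e1
  (Defs.norm_has_inf (Ep_seminorm S p1) (lmod_pi (lp_const S p1) (MkEp (memE g)))).
have {}vM : Ep_norm v <= `|M| + 1.
  apply/ltW/(lt_le_trans vM).
  by rewrite -lerBrDr opprB addrCA subrr addr0.
move: vE => /lmod_piP; rewrite inE /= => -[f [k [foo fE]]].
apply: (Hn g v f k) => //.
  apply/funext => x; have := congr1 (fun u => u x) fE.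
  rewrite /= !fctE => E.
  by rewrite -addrA -E; ring.
have vfin : (Ep_energy S p v < +oo)%E by have := valP v; rewrite inE.
have half0 : 0 <= 2^-1 :> R by rewrite invr_ge0.
exact: (wsum_le_wnorm half0 p1 vfin vM).
Qed.
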